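(* Suppose that $M$ is a Hölder continuous function on $\Sigma_A$ taking values in the set of positive $d\times d$ matrices (all entries strictly positive). Then for any $q\in\mathbb{R}$ there is a unique $\sigma$-invariant, ergodic probability measure $\mu_q$ on $\Sigma_A$ for which one can find constants $C_1>0$, $C_2>0$ such that $$C_1\le \frac{\mu_q([J])}{\exp(-nP(q))\cdot\|M(x)M(\sigma x)\cdots M(\sigma^{n-1}x)\|^q}\le C_2$$ for any $n>0$, $J\in\Sigma_{A,n}$ and $x\in[J]$.
   Context: Let $m\ge 2$, $\Sigma=\{1,\dots,m\}^{\mathbb{N}}$, with the left shift $\sigma$ and the metric $d(x,y)=m^{-n}$ for $x\neq y$, where $n$ is the smallest $k$ with $x_k\ne y_k$. Let $A$ be an $m\times m$ matrix with entries $0$ or $1$, assumed primitive (some power $A^p$ has all entries strictly positive). $\Sigma_A=\{x\in\Sigma: A_{x_k,x_{k+1}}=1\ \text{for all } k\}$ is the associated subshift of finite type. $\Sigma_{A,n}$ is the set of admissible words $J=j_1\cdots j_n$ of length $n$ over $\{1,\dots,m\}$ (that is, $A_{j_k,j_{k+1}}=1$ for $1\le k<n$), and $[J]=\{x\in\Sigma_A: x_i=j_i,\ 1\le i\le n\}$ is the cylinder set. The matrix norm is $\|B\|=\mathbf{1}^tB\mathbf{1}$ with $\mathbf{1}^t=(1,\dots,1)$ (the sum of all entries). The pressure function of $M$ is $$P(q)=\lim_{n\to\infty}\frac1n\log\sum_{J\in\Sigma_{A,n}}\ \sup_{x\in[J]}\|M(x)M(\sigma x)\cdots M(\sigma^{n-1}x)\|^q,$$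 the limit existing for every $q\in\mathbb{R}$ in this setting. *)

(* Defs.v *)
From HB Require Import structures.
From mathcomp Require Import all_boot all_order all_algebra.
From mathcomp Require Import all_classical all_reals all_analysis.

Set Implicit Arguments.
Unset Strict Implicit.
Unset Printing Implicit Defensive.

Import Order.TTheory GRing.Theory Num.Theory.
Import numFieldNormedType.Exports.

Local Open Scope classical_set_scope.
Local Open Scope ring_scope.

Definition zero_one_mx m (A : 'M[nat]_m) : Prop :=
  forall i j, A i j = 0%N \/ A i j = 1%N.

Definition primitive_mx m (A : 'M[nat]_m) : Prop :=
  exists p : nat, forall i j, (0 < (A ^+ p) i j)%N.

(* Sequences are indexed from 0: the coordinate written x_k, k >= 1, is [x k.-1]. *)
Definition full_shift (m : nat) : Type := nat -> 'I_m.

Definition Sigma_A m (A : 'M[nat]_m) : set (full_shift m) :=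
  [set x | forall k : nat, A (x k) (x k.+1) = 1%N].

Definition sft m (A : 'M[nat]_m) : Type := {x : full_shift m | Sigma_A A x}.

Definition shift_fun m (x : full_shift m) : full_shift m := fun k => x k.+1.

Definition shift_map m (A : 'M[nat]_m) (x : sft A) : sft A :=
  exist (Sigma_A A) (shift_fun (sval x)) (fun k => svalP x k.+1).

(* The exponent is [k.+1], with k the least 0-based index of disagreement,
   because the metric is stated for sequences indexed from 1. *)
Definition seq_dist (R : realType) m (x y : full_shift m) : R :=
  if pselect (exists k : nat, x k != y k) is left xy
  then m%:R ^- (ex_minn xy).+1 else 0.

Definition sft_dist (R : realType) m (A : 'M[nat]_m) (x y : sft A) : R :=
  seq_dist R (sval x) (sval y).

Definition sft_open (R : realType) m (A : 'M[nat]_m) : set (set (sft A)) :=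
  [set U | forall x, U x ->
     exists2 e : R, 0 < e & forall y, sft_dist R x y < e -> U y].

Lemma sft_nonempty m (A : 'M[nat]_m) :
  (2 <= m)%N -> zero_one_mx A -> primitive_mx A -> [set: sft A] !=set0.
Proof.
move=> m2 A01 [[|p] Ap].
  have lt0 : (0 < m)%N by apply: leq_trans m2.
  by have := Ap (Ordinal lt0) (Ordinal m2); rewrite expr0 mxE.
have next i : {j | A i j = 1%N}.
  apply: cid; apply: contrapT => Ai.
  have := Ap i i; rewrite exprS mxE big1// => j _.
  by case: (A01 i j) => [->|Aij]; [rewrite mul0r|case: Ai; exists j].
have lt0 : (0 < m)%N by apply: leq_trans m2.
pose x k := iter k (fun i => sval (next i)) (Ordinal lt0).
have Ax : Sigma_A A x by move=> k; exact: (svalP (next (x k))).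
by exists (exist _ x Ax).
Qed.

(* Measurable types are pointed in the library; the proof of nonemptiness [ne]
   only serves to provide the point. *)
Definition pointed_sft m (A : 'M[nat]_m) (ne : [set: sft A] !=set0) : Type :=
  sft A.

HB.instance Definition _ m (A : 'M[nat]_m) (ne : [set: sft A] !=set0) :=
  gen_eqMixin (pointed_sft ne).
HB.instance Definition _ m (A : 'M[nat]_m) (ne : [set: sft A] !=set0) :=
  gen_choiceMixin (pointed_sft ne).
HB.instance Definition _ m (A : 'M[nat]_m) (ne : [set: sft A] !=set0) :=
  isPointed.Build (pointed_sft ne) (sval (cid ne)).

Definition borel_sft (R : realType) m (A : 'M[nat]_m)
    (ne : [set: sft A] !=set0) :=
  g_sigma_algebraType (sft_open R (A := A) : set (set (pointed_sft ne))).

Definition admissible m (A : 'M[nat]_m) n (J : n.-tuple 'I_m) : bool :=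
  sorted (fun i j => A i j == 1%N) J.

Definition cylinder m (A : 'M[nat]_m) n (J : n.-tuple 'I_m) : set (sft A) :=
  [set x : sft A | forall i : 'I_n, sval x i = tnth J i].
Arguments cylinder {m} A {n} J.

Definition entry_norm (R : realType) d (B : 'M[R]_d) : R := \sum_i \sum_j B i j.

Definition cocycle (R : realType) d m (A : 'M[nat]_m) (M : sft A -> 'M[R]_d)
    (n : nat) (x : sft A) : 'M[R]_d :=
  \prod_(k < n) M (iter k (@shift_map m A) x).

Definition holder_continuous (R : realType) d m (A : 'M[nat]_m)
    (M : sft A -> 'M[R]_d) : Prop :=
  exists a C : R, 0 < a /\
    forall x y : sft A, mx_norm (M x - M y) <= C * sft_dist R x y `^ a.

Definition pressure (R : realType) d m (A : 'M[nat]_m) (M : sft A -> 'M[R]_d)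
    (q : R) : R :=
  lim ((fun n : nat => n%:R^-1 *
    ln (\sum_(J : n.-tuple 'I_m | admissible A J)
          sup [set entry_norm (cocycle M n x) `^ q | x in cylinder A J])) @ \oo).

Definition shift_invariant (R : realType) m (A : 'M[nat]_m)
    (ne : [set: sft A] !=set0) (mu : probability (borel_sft R ne) R) : Prop :=
  forall B : set (borel_sft R ne), measurable B ->
    mu (@shift_map m A @^-1` B) = mu B.

Definition ergodic (R : realType) m (A : 'M[nat]_m)
    (ne : [set: sft A] !=set0) (mu : probability (borel_sft R ne) R) : Prop :=
  forall B : set (borel_sft R ne), measurable B ->
    @shift_map m A @^-1` B = B -> mu B = 0%E \/ mu B = 1%E.

Definition gibbs_bounds (R : realType) d m (A : 'M[nat]_m)
    (ne : [set: sft A] !=set0) (M : sft A -> 'M[R]_d) (q : R)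
    (mu : probability (borel_sft R ne) R) : Prop :=
  exists C1 C2 : R, [/\ 0 < C1, 0 < C2 &
    forall (n : nat) (J : n.-tuple 'I_m) (x : sft A),
      (0 < n)%N -> admissible A J -> cylinder A J x ->
      C1 <= fine (mu (cylinder A J)) /
            (expR (- (n%:R * pressure M q)) * entry_norm (cocycle M n x) `^ q) <= C2].

(* Main.v *)
Require Import Defs.
From HB Require Import structures.
From mathcomp Require Import all_boot all_order all_algebra.
From mathcomp Require Import all_classical all_reals all_analysis.
From mathcomp Require Import ring lra.

Set Implicit Arguments.
Unset Strict Implicit.
Unset Printing Implicit Defensive.

Import Order.TTheory GRing.Theory Num.Theory.
Import numFieldNormedType.Exports.

Local Open Scope classical_set_scope.
Local Open Scope ring_scope.

(** Write [phi n x] for the norm of the product of [M] along the first [n]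
    points of the orbit of [x].  Two properties of positive matrices reduce the
    theorem to combinatorics of words.  Holder continuity gives bounded
    distortion: [phi n] varies by at most a constant factor on a cylinder of
    length [n] ([cocycle_distortion]).  Since the row sums of a product of
    positive matrices are mutually comparable, the norm is multiplicative up to
    a constant: [phi (n + k) x] is comparable to [phi n x] times [phi k] at the
    [n]-th iterate of [x] ([cocycle_quasi_multiplicative]).  Both survive raising
    to the power [q], whatever its sign.  So the value of [phi n x `^ q] at any
    point [x] of a cylinder defines a weight on words, submultiplicative under
    concatenation, and supermultiplicative when words of a fixed length, which
    primitivity of [A] provides, are inserted between the two factors
    ([orbit_weight_quasi_bernoulli]).

    For such a weight the partition sums are multiplicative up to a constant, so
    they equal [expR (n * P)] up to a bounded factor; this [P] is the pressure.
    After normalization by [expR (- n * P)], averaging over extensions of a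
    word to the right and then to the left, by means of a shift-invariant mean
    on bounded sequences, yields a function on words that is consistent,
    shift-invariant and still comparable to the weight
    ([invariant_word_measure]).  It is realized by a probability measure, the
    image of Lebesgue measure under the coding of the unit interval by nested
    intervals ([measure_of_words]).

    Supermultiplicativity bounds below the measure of the points of one clopen
    set that a fixed iterate sends to another.  An invariant Borel set is
    approximated by clopen sets, and the bound forces its measure to be [0] or
    [1] ([ergodic_of_words]).  Finally, any two measures satisfying the Gibbs
    bounds have a bounded ratio on cylinders, hence on Borel sets, and an
    invariant probability measure that is absolutely continuous with respect to
    an invariant ergodic one is equal to it ([ergodic_absolutely_continuous_eq]). *)

(** * Sums over words *)

Section WordSums.
Variables (R : realType) (T : finType).
Implicit Types (f g : seq T -> R) (s t : seq T) (n k : nat).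

(** Recursion on the length, rather than a sum over tuples, lets words of
    different lengths be concatenated without casts. *)
Fixpoint wsum n f : R :=
  if n is n'.+1 then \sum_(a : T) wsum n' (fun s => f (a :: s)) else f [::].

Lemma wsumE n f : wsum n f = \sum_(J : n.-tuple T) f J.
Proof.
elim: n f => [|n IH] f /=.
  by rewrite (big_pred1 [tuple]) // => J; apply/esym/eqP; exact: tuple0.
transitivity (\sum_(a : T) \sum_(J : n.-tuple T) f (a :: J)).
  by apply: eq_bigr => a _; rewrite IH.
rewrite pair_big /= (reindex (fun J : n.+1.-tuple T => (thead J, behead_tuple J))).
  by apply: eq_bigr => J _ /=; rewrite [in RHS](tuple_eta J).
exists (fun p : T * n.-tuple T => [tuple of p.1 :: p.2]) => [J _|[a J] _] /=.
  by rewrite -tuple_eta.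
by rewrite theadE; congr pair; apply: val_inj.
Qed.

Lemma eq_wsum n f g : (forall s, size s = n -> f s = g s) -> wsum n f = wsum n g.
Proof.
by move=> fg; rewrite !wsumE; apply: eq_bigr => J _; rewrite fg ?size_tuple.
Qed.

Lemma ler_wsum n f g :
  (forall s, size s = n -> f s <= g s) -> wsum n f <= wsum n g.
Proof.
by move=> fg; rewrite !wsumE; apply: ler_sum => J _; rewrite fg ?size_tuple.
Qed.

Lemma wsum_ge0 n f : (forall s, 0 <= f s) -> 0 <= wsum n f.
Proof. by move=> f0; rewrite wsumE; apply: sumr_ge0. Qed.

Lemma wsumZ n (c : R) f : wsum n (fun s => c * f s) = c * wsum n f.
Proof. by rewrite !wsumE mulr_sumr. Qed.

Lemma wsumM n k f g :
  wsum n f * wsum k g = wsum n (fun s => wsum k (fun t => f s * g t)).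
Proof.
by rewrite [wsum n f]wsumE mulr_suml [RHS]wsumE; apply: eq_bigr => J _; rewrite wsumZ.
Qed.

Lemma wsum_sum n (F : T -> seq T -> R) :
  wsum n (fun s => \sum_a F a s) = \sum_a wsum n (F a).
Proof.
by rewrite wsumE exchange_big /=; apply: eq_bigr => a _; rewrite wsumE.
Qed.

Lemma wsum_exchange n k (F : seq T -> seq T -> R) :
  wsum n (fun s => wsum k (F s)) = wsum k (fun t => wsum n (F^~ t)).
Proof.
rewrite !wsumE; under eq_bigr do rewrite wsumE.
rewrite exchange_big /=.
by apply: eq_bigr => J _; rewrite wsumE.
Qed.

Lemma wsumD n k f :
  wsum (n + k) f = wsum n (fun s => wsum k (fun t => f (s ++ t))).
Proof.
by elim: n f => [//|n IH] f; rewrite addSn /=; apply: eq_bigr => a _; rewrite IH.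
Qed.

Lemma wsumSr n f : wsum n.+1 f = wsum n (fun s => \sum_a f (rcons s a)).
Proof.
rewrite -addn1 wsumD; apply: eq_wsum => s _ /=.
by apply: eq_bigr => a _; rewrite cats1.
Qed.

Lemma wsum_ge_term n f s : (forall s, 0 <= f s) -> size s = n -> f s <= wsum n f.
Proof.
move=> f0 sn; rewrite wsumE (bigD1 (tcast sn (in_tuple s))) //= val_tcast.
by rewrite lerDl sumr_ge0.
Qed.

End WordSums.

(** * Two limiting devices *)

Section QuasiAdditive.
Variable R : realType.

(** Fekete's lemma, two-sided: [a - C] is superadditive and [a + C] is
    subadditive, so each quotient [(a n - C) / n] is at most each quotient
    [(a k + C) / k], and any number in between serves as the slope. *)
Lemma quasi_additive_slope (a : nat -> R) (C : R) :
  (forall i j, `|a (i + j)%N - a i - a j| <= C) ->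
  exists P : R, forall n, `|a n - n%:R * P| <= C.
Proof.
move=> aC.
have C0 : 0 <= C by apply: le_trans (aC 0%N 0%N).
have mulC k n : (0 < k)%N -> `|a (k * n)%N - k%:R * a n| <= k.-1%:R * C.
  case: k => // k _; elim: k => [|k IH]; first by rewrite mul1n mul1r subrr normr0 mul0r.
  have := aC n (k.+1 * n)%N; rewrite -mulSn => h.
  have -> : a (k.+2 * n)%N - k.+2%:R * a n =
     (a (k.+2 * n)%N - a n - a (k.+1 * n)%N) + (a (k.+1 * n)%N - k.+1%:R * a n).
    by rewrite (mulrS 1 k.+1); ring.
  have -> : k.+2.-1%:R * C = C + k.+1.-1%:R * C :> R by rewrite /= (mulrS 1 k); ring.
  by rewrite (le_trans (ler_normD _ _)) // lerD.
pose S := [set (a n.+1 - C) / n.+1%:R | n in [set: nat]].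
have key n k : (a n.+1 - C) / n.+1%:R <= (a k.+1 + C) / k.+1%:R.
  rewrite ler_pdivrMr // mulrAC ler_pdivlMr //.
  have /(_ isT) := mulC k.+1 n.+1; rewrite ler_norml => /andP[h1 _].
  have /(_ isT) := mulC n.+1 k.+1; rewrite ler_norml => /andP[_ h2].
  rewrite mulnC in h2.
  have p1 : (k.+1.-1)%:R * C = k.+1%:R * C - C :> R by rewrite /= (mulrS 1 k); ring.
  have p2 : (n.+1.-1)%:R * C = n.+1%:R * C - C :> R by rewrite /= (mulrS 1 n); ring.
  rewrite p1 in h1; rewrite p2 in h2.
  lra.
have ubS k : ubound S ((a k.+1 + C) / k.+1%:R) by move=> _ [n _ <-].
have S0 : S !=set0 by exists ((a 1%N - C) / 1%:R), 0%N.
exists (sup S) => -[|n].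
  by rewrite mul0r subr0; have := aC 0%N 0%N; rewrite addn0 subrr sub0r normrN.
rewrite ler_norml; apply/andP; split.
  have : sup S <= (a n.+1 + C) / n.+1%:R by apply: ge_sup.
  rewrite ler_pdivlMr // => h; lra.
have : (a n.+1 - C) / n.+1%:R <= sup S.
  by apply: ub_le_sup; [exists ((a 1%N + C) / 1%:R); exact: ubS | exists n].
rewrite ler_pdivrMr // => h; lra.
Qed.

End QuasiAdditive.

Section BanachLimit.
Variable R : realType.
Implicit Types u v : nat -> R.

Definition bounded_seq u := exists B : R, forall n, `|u n| <= B.

Definition cesaro u (n : nat) : R := n.+1%:R^-1 * \sum_(i < n.+1) u i.

Lemma cesaro_bounded u (B : R) n : (forall n, `|u n| <= B) -> `|cesaro u n| <= B.
Proof.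
move=> uB; rewrite /cesaro normrM ger0_norm ?invr_ge0 ?ler0n // mulrC.
rewrite ler_pdivrMr // (le_trans (ler_norm_sum _ _ _)) //.
rewrite (le_trans (ler_sum _ (fun (i : 'I_n.+1) _ => uB i))) //.
by rewrite sumr_const card_ord mulr_natr.
Qed.

(** Shift-invariant means exist because the limit along an ultrafilter exists
    for every bounded sequence and the Cesaro averages of a sequence and of
    its shift are asymptotic. *)
Lemma banach_limit : exists Lim : (nat -> R) -> R,
  [/\ forall u v, bounded_seq u -> bounded_seq v ->
        Lim (fun n => u n + v n) = Lim u + Lim v,
      forall u v, bounded_seq u -> bounded_seq v ->
        (forall n, u n <= v n) -> Lim u <= Lim v,
      forall c, Lim (fun=> c) = c &
      forall u, bounded_seq u -> Lim (fun n => u n.+1) = Lim u].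
Proof.
have [U [UU subU]] := ultraFilterLemma (F := \oo) _.
pose L u : R := lim (cesaro u @ U).
have cvgL u : bounded_seq u -> cesaro u @ U --> L u.
  move=> [B uB].
  have /(_ (cesaro u @ U) _) [] : compact `[- B, B]%classic by apply: segment_compact.
    apply: (@filterE _ U _ (cesaro u @^-1` `[- B, B])) => n /=.
    by rewrite in_itv /= -ler_norml; exact: cesaro_bounded.
  move=> l [_ cl]; apply/cvg_ex; exists l => V lV.
  have [//|UVC] := in_ultra_setVsetC (cesaro u @^-1` V) UU.
  by have [x [xV]] := cl (~` V) V UVC lV.
have cesaro_cst c n : cesaro (fun=> c) n = c.
  by rewrite /cesaro sumr_const card_ord -[c *+ _]mulr_natl mulKf.
exists L; split.
- move=> u v bu bv; apply/cvg_lim => //.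
  have -> : cesaro (fun n => u n + v n) = (fun n => cesaro u n + cesaro v n).
    by apply/funext => n; rewrite /cesaro big_split mulrDr.
  by apply: cvgD; exact: cvgL.
- move=> u v bu bv uv; apply: (ler_lim (cvgP _ (cvgL _ bu)) (cvgP _ (cvgL _ bv))).
  apply: filterE => n; rewrite /cesaro ler_pM2l ?invr_gt0 //.
  exact: ler_sum.
- move=> c; apply/cvg_lim => //.
  have -> : cesaro (fun=> c) = cst c by apply/funext => n; rewrite cesaro_cst.
  exact: cvg_cst.
- move=> u [B uB]; apply/cvg_lim => //.
  have -> : cesaro (fun n => u n.+1) =
      (fun n => cesaro u n + (u n.+1 - u 0%N) * n.+1%:R^-1).
    apply/funext => n; rewrite /cesaro [in LHS]mulrC [in RHS]mulrC -mulrDl.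
    congr (_ * _); rewrite [in RHS]big_ord_recl big_ord_recr /=.
    under [in RHS]eq_bigr do rewrite /bump leq0n add1n.
    ring.
  rewrite -[X in _ --> X]addr0; apply: cvgD; first by apply: cvgL; exists B.
  apply: (cvg_trans (G := (fun n => (u n.+1 - u 0%N) * n.+1%:R^-1) @ \oo)).
    by move=> X; exact: subU.
  apply: (@squeeze_cvgr _ _ _ _ (fun n => - (B + B) * n.+1%:R^-1) (fun n => (B + B) * n.+1%:R^-1)).
  + near=> n.
    rewrite mulNr -ler_norml normrM [X in _ * X]ger0_norm ?invr_ge0 //.
    rewrite ler_wpM2r ?invr_ge0 //.
    by rewrite (le_trans (ler_normB _ _)) // lerD.
  + rewrite -[X in _ --> X](mulr0 (- (B + B))); apply: cvgMr; exact: cvg_harmonic.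
  + rewrite -[X in _ --> X](mulr0 (B + B)); apply: cvgMr; exact: cvg_harmonic.
Unshelve. all: by end_near.
Qed.

End BanachLimit.

(** * From quasi-multiplicative weights to shift-invariant word measures *)

Section WordMeasure.
Variables (R : realType) (T : finType).
Implicit Types (p w : seq T -> R) (s t : seq T).

Definition comparable_weights p w :=
  exists c C : R, [/\ 0 < c, 0 < C & forall s, c * w s <= p s <= C * w s].

(** In a subshift two admissible words need not have an admissible concatenation,
    so a lower bound can only hold after summing over the words that connect
    them; for a primitive matrix these can be given a common length [gap]. *)
Record quasi_bernoulli (w : seq T -> R) (D : R) (gap : nat) : Prop :=
  QuasiBernoulli {
    qb_ge0 : forall s, 0 <= w s ;
    qb_const : 0 < D ;
    qb_upper : forall s t, w (s ++ t) <= D * (w s * w t) ;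
    qb_lower : forall s t, w s * w t <= D * wsum gap (fun u => w (s ++ u ++ t)) }.

(** The two inequalities make the logarithms of the partition sums [wsum n w]
    additive up to a constant. *)
Lemma quasi_bernoulli_pressure w D gap :
  quasi_bernoulli w D gap -> (forall n, 0 < wsum n w) ->
  exists P c C : R, [/\ 0 < c, 0 < C &
    forall n, c * expR (n%:R * P) <= wsum n w <= C * expR (n%:R * P)].
Proof.
move=> [w0 D0 wD wL] Z0.
have up i j : wsum (i + j) w <= D * (wsum i w * wsum j w).
  rewrite wsumD wsumM -wsumZ; apply: ler_wsum => s _.
  by rewrite -wsumZ; apply: ler_wsum.
pose E := D * (D * wsum gap w).
have E0 : 0 < E by rewrite !mulr_gt0.
have low i j : wsum i w * wsum j w <= E * wsum (i + j) w.
  have h1 : wsum i w * wsum j w <= D * wsum (i + (gap + j)) w.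
    rewrite wsumM wsumD -wsumZ; apply: ler_wsum => s _.
    by rewrite wsumD wsum_exchange -wsumZ; apply: ler_wsum.
  rewrite (le_trans h1) // /E -!mulrA ler_pM2l // mulrA.
  by rewrite addnCA (le_trans (up _ _)) // mulrA.
pose K := `|ln D| + `|ln E|.
have [|P hP] := @quasi_additive_slope R (fun n => ln (wsum n w)) K.
  move=> i j.
  have p1 : ln (wsum (i + j) w) <= ln D + (ln (wsum i w) + ln (wsum j w)).
    by rewrite -!lnM ?posrE ?mulr_gt0 // ler_ln ?posrE ?mulr_gt0.
  have p2 : ln (wsum i w) + ln (wsum j w) <= ln E + ln (wsum (i + j) w).
    by rewrite -!lnM ?posrE ?mulr_gt0 // ler_ln ?posrE ?mulr_gt0.
  have := ler_norm (ln D); have := ler_norm (ln E).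
  have := normr_ge0 (ln D); have := normr_ge0 (ln E).
  rewrite /K ler_norml => *; apply/andP; split; lra.
exists P, (expR (- K)), (expR K); split; rewrite ?expR_gt0 // => n.
have := hP n; rewrite ler_norml => /andP[h1 h2].
rewrite -!expRD -[X in _ <= X <= _](lnK (Z0 n)) !ler_expR.
apply/andP; split; lra.
Qed.

(** An exponential factor in the length is multiplicative under concatenation, so
    only the connecting words, of fixed length, affect the constant. *)
Lemma quasi_bernoulli_normalize w D gap (P : R) :
  quasi_bernoulli w D gap ->
  exists E, quasi_bernoulli (fun s => expR (- ((size s)%:R * P)) * w s) E gap.
Proof.
move=> [w0 D0 wD wL].
exists (D + D * expR (gap%:R * P)); split.
- by move=> s; rewrite mulr_ge0 ?expR_ge0.
- by rewrite addr_gt0 // mulr_gt0 ?expR_gt0.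
- move=> s t; rewrite size_cat natrD mulrDl opprD expRD.
  have -> : expR (- ((size s)%:R * P)) * w s * (expR (- ((size t)%:R * P)) * w t)
    = expR (- ((size s)%:R * P)) * expR (- ((size t)%:R * P)) * (w s * w t).
    ring.
  rewrite mulrCA ler_pM2l ?mulr_gt0 ?expR_gt0 // (le_trans (wD s t)) //.
  by rewrite ler_wpM2r ?mulr_ge0 // lerDl mulr_ge0 ?expR_ge0 // ltW.
move=> s t; rewrite mulrDl -[X in X <= _]add0r lerD //.
  rewrite mulr_ge0 ?(ltW D0) //; apply: wsum_ge0 => u.
  by rewrite mulr_ge0 ?expR_ge0.
have -> : expR (- ((size s)%:R * P)) * w s * (expR (- ((size t)%:R * P)) * w t)
    = expR (- ((size s)%:R * P)) * expR (- ((size t)%:R * P)) * (w s * w t).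
  ring.
pose F u := expR (- (gap%:R * P)) *
  (expR (- ((size s)%:R * P)) * expR (- ((size t)%:R * P)) * w (s ++ u ++ t)).
rewrite (@eq_wsum _ _ _ _ F); last first.
  move=> u su; rewrite /F !size_cat su !natrD !mulrDl !opprD !expRD; ring.
rewrite wsumZ wsumZ -[D * _]mulrC [leRHS]mulrACA -[X in _ <= X * _]expRD subrr expR0 mul1r.
by rewrite [leRHS]mulrCA ler_pM2l ?mulr_gt0 ?expR_gt0.
Qed.

(** The lower bound passes to comparable functions; for a measure it says that
    any two cylinders are visited in succession with a probability bounded below
    by the product of their measures. *)
Lemma comparable_quasi_bernoulli p w D gap :
  quasi_bernoulli w D gap -> comparable_weights p w ->
  exists K, 0 < K /\
    forall s t, p s * p t <= K * wsum gap (fun u => p (s ++ u ++ t)).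
Proof.
move=> [w0 D0 wD wL] [c [C [c0 C0 pw]]].
have p0 s : 0 <= p s.
  by have /andP[h _] := pw s; rewrite (le_trans _ h) // mulr_ge0 // ltW.
exists (C * C * D / c); split; first by rewrite divr_gt0 // !mulr_gt0.
move=> s t; apply: (@le_trans _ _ (C * C * (w s * w t))).
  have /andP[_ hs] := pw s; have /andP[_ ht] := pw t.
  by rewrite mulrACA ler_pM.
rewrite -!mulrA !ler_pM2l // (le_trans (wL s t)) // ler_pM2l //.
rewrite ler_pdivlMl // -wsumZ; apply: ler_wsum => u _.
by have /andP[] := pw (s ++ u ++ t).
Qed.

Lemma Banach_limit_sum (Lim : (nat -> R) -> R) (F : T -> nat -> R) :
  (forall u v, bounded_seq u -> bounded_seq v ->
     Lim (fun n => u n + v n) = Lim u + Lim v) ->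
  (forall c, Lim (fun=> c) = c) ->
  (forall a, bounded_seq (F a)) ->
  Lim (fun n => \sum_a F a n) = \sum_a Lim (F a).
Proof.
move=> LD Lc bF.
suff [_ //] : bounded_seq (fun n => \sum_a F a n) /\
    Lim (fun n => \sum_a F a n) = \sum_a Lim (F a).
elim: (index_enum T) => [|a r [[B hB] IH]].
  split; last first.
    by under eq_fun do rewrite big_nil; rewrite Lc big_nil.
  by exists 0 => n; rewrite big_nil normr0.
have [Ba hBa] := bF a.
split.
  by exists (Ba + B) => n; rewrite big_cons (le_trans (ler_normD _ _)) ?lerD.
under eq_fun do rewrite big_cons.
by rewrite big_cons -IH LD //; exists B.
Qed.

(** Averaging the weights of extensions to the right, with a Banach limit,
    makes them consistent; averaging the result over extensions to the left then
    makes it shift-invariant.  Each step changes [w] by bounded factors only,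
    which is where the two quasi-Bernoulli inequalities enter. *)
Lemma invariant_word_measure w D gap (c C : R) :
  quasi_bernoulli w D gap -> 0 < c -> (forall n, c <= wsum n w <= C) ->
  exists p, [/\ p [::] = 1,
    forall s, p s = \sum_a p (rcons s a),
    forall s, p s = \sum_a p (a :: s) &
    comparable_weights p w].
Proof.
move=> [w0 D0 wD wL] c0 cZC.
have C0 : 0 < C by have /andP[h1 h2] := cZC 0%N; rewrite (lt_le_trans c0) // (le_trans h1).
have Z0 n : 0 < wsum n w by have /andP[h _] := cZC n; rewrite (lt_le_trans c0).
have ext_up s n : wsum n (fun t => w (s ++ t)) <= D * C * w s.
  rewrite (@le_trans _ _ (D * w s * wsum n w)) //.
    by rewrite -wsumZ; apply: ler_wsum => t _; rewrite -mulrA.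
  by rewrite [leRHS]mulrAC ler_wpM2l ?mulr_ge0 ?(ltW D0) //; have /andP[] := cZC n.
have ext_low s n : c / D * w s <= wsum (gap + n) (fun t => w (s ++ t)).
  rewrite mulrAC ler_pdivrMr // mulrC (@le_trans _ _ (w s * wsum n w)) //.
    by rewrite ler_wpM2l //; have /andP[] := cZC n.
  rewrite -wsumZ wsumD wsum_exchange mulrC -wsumZ; apply: ler_wsum => t _.
  exact: wL.
have [Lim [LD Lmono Lc LS]] := banach_limit R.
(* By shift invariance only a tail of the sequence matters. *)
have Lshift (u : nat -> R) N : bounded_seq u -> Lim (fun n => u (N + n)%N) = Lim u.
  move=> [B hB]; elim: N => [//|N <-].
  rewrite -(LS (fun n => u (N + n)%N)); last by exists B.
  by congr Lim; apply/funext => n; rewrite addnS.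
have Lle (u : nat -> R) (b : R) N : bounded_seq u ->
    (forall n, u (N + n)%N <= b) -> Lim u <= b.
  move=> bu ub; rewrite -(Lshift _ N bu) -[leRHS]Lc; apply: Lmono => //.
    by case: bu => B hB; exists B => n.
  by exists `|b|.
have Lge (u : nat -> R) (b : R) N : bounded_seq u ->
    (forall n, b <= u (N + n)%N) -> b <= Lim u.
  move=> bu ub; rewrite -(Lshift _ N bu) -[leLHS]Lc; apply: Lmono => //.
    by exists `|b|.
  by case: bu => B hB; exists B => n.
pose f s n := wsum n (fun t => w (s ++ t)) / wsum (size s + n) w.
pose nu s := Lim (f s).
have f_ge0 s n : 0 <= f s n by rewrite divr_ge0 ?wsum_ge0 // ltW.
have f_up s n : f s n <= D * C / c * w s.
  rewrite ler_pdivrMr // (le_trans (ext_up s n)) //.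
  rewrite -!mulrA ler_pM2l // ler_pM2l // mulrCA ler_peMr //.
  by rewrite ler_pdivlMl // mulr1; have /andP[] := cZC (size s + n)%N.
have f_bnd s : bounded_seq (f s).
  by exists (D * C / c * w s) => n; rewrite ger0_norm.
have f_low s n : c / D / C * w s <= f s (gap + n)%N.
  rewrite ler_pdivlMr // (le_trans _ (ext_low s n)) //.
  rewrite -!mulrA ler_pM2l // ler_pM2l ?invr_gt0 // mulrCA ler_piMr //.
  by rewrite ler_pdivrMl // mulr1; have /andP[] := cZC (size s + (gap + n))%N.
have nu_up s : nu s <= D * C / c * w s by apply: (Lle _ _ 0%N).
have nu_low s : c / D / C * w s <= nu s by apply: (Lge _ _ gap).
have nu_nil : nu [::] = 1.
  rewrite -[RHS]Lc; congr Lim; apply/funext => n.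
  by rewrite /f /= divff // gt_eqF.
have nu_rcons s : nu s = \sum_a nu (rcons s a).
  rewrite -Banach_limit_sum //.
  rewrite /nu -LS //; congr Lim; apply/funext => n.
  rewrite /f /= mulr_suml; apply: eq_bigr => a _; rewrite size_rcons addnS.
  by congr (_ / _); apply: eq_wsum => t _; rewrite cat_rcons.
pose g s n := wsum n (fun r => nu (r ++ s)).
pose p s := Lim (g s).
have c'0 : 0 < c / D / C by rewrite !divr_gt0.
have nu_ge0 s : 0 <= nu s by rewrite (le_trans _ (nu_low s)) // mulr_ge0 // ltW.
have g_ge0 s n : 0 <= g s n by rewrite wsum_ge0.
pose A1 := D * C / c * (D * C).
have A10 : 0 < A1 by rewrite !mulr_gt0 ?invr_gt0.
have g_up s n : g s n <= A1 * w s.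
  rewrite (@le_trans _ _ (wsum n (fun r => D * C / c * w (r ++ s)))) //.
    by apply: ler_wsum.
  rewrite wsumZ /A1 -[leRHS]mulrA ler_pM2l ?divr_gt0 ?mulr_gt0 //.
  rewrite (@le_trans _ _ (D * w s * wsum n w)) //.
    rewrite -wsumZ; apply: ler_wsum => t _; rewrite -mulrA [w s * _]mulrC.
    exact: wD.
  by rewrite [leRHS]mulrAC ler_wpM2l ?mulr_ge0 ?(ltW D0) //; have /andP[] := cZC n.
have g_bnd s : bounded_seq (g s).
  by exists (A1 * w s) => n; rewrite ger0_norm.
pose B1 := c / D / C * (c / D).
have g_low s n : B1 * w s <= g s (gap + n)%N.
  rewrite (@le_trans _ _ (wsum (gap + n) (fun r => c / D / C * w (r ++ s)))) //; last first.
    by apply: ler_wsum.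
  rewrite wsumZ /B1 -[leLHS]mulrA ler_pM2l //.
  rewrite mulrAC ler_pdivrMr // mulrC (@le_trans _ _ (w s * wsum n w)) //.
    by rewrite ler_wpM2l //; have /andP[] := cZC n.
  rewrite -wsumZ addnC wsumD mulrC -wsumZ; apply: ler_wsum => t _.
  rewrite mulrC; apply: (le_trans (wL t s)); rewrite ler_pM2l //.
  by apply: ler_wsum => u _; rewrite catA.
exists p; split.
- rewrite -[RHS]Lc; congr Lim; apply/funext => n; rewrite /g.
  elim: n => [|n IH]; first by rewrite /= nu_nil.
  rewrite wsumSr -[RHS]IH; apply: eq_wsum => r _; rewrite cats0 nu_rcons.
  by apply: eq_bigr => a _; rewrite cats0.
- move=> s; rewrite -Banach_limit_sum //.
  congr Lim; apply/funext => n; rewrite -wsum_sum; apply: eq_wsum => r _.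
  by rewrite nu_rcons; apply: eq_bigr => a _; rewrite rcons_cat.
- move=> s; rewrite -Banach_limit_sum //.
  rewrite /p -LS //; congr Lim; apply/funext => n; rewrite /g wsumSr -wsum_sum.
  by apply: eq_wsum => r _; apply: eq_bigr => a _; rewrite cat_rcons.
- exists B1, A1; split => //; first by rewrite !mulr_gt0 ?invr_gt0.
  by move=> s; apply/andP; split; [apply: (Lge _ _ gap) | apply: (Lle _ _ 0%N)].
Qed.

End WordMeasure.

(** * Borel sets of the subshift and their approximation by clopen sets *)

Section ShiftSpace.
Variables (R : realType) (m : nat) (A : 'M[nat]_m).
Implicit Types (x y : sft A) (n k : nat).

Definition word x n : seq 'I_m := mkseq (sval x) n.

Lemma size_word x n : size (word x n) = n.
Proof. exact: size_mkseq. Qed.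

Lemma take_word x n k : take n (word x (n + k)) = word x n.
Proof. by rewrite /word /mkseq iotaD map_cat take_size_cat // size_map size_iota. Qed.

Lemma drop_word x n k : drop n (word x (n + k)) = word (iter n (@shift_map m A) x) k.
Proof.
rewrite /word /mkseq iotaD map_cat drop_size_cat ?size_map ?size_iota //.
rewrite add0n -[n in LHS]addn0 iotaDl -map_comp; apply: eq_map => i /=.
by elim: n x i => [|n IH] x i //=; rewrite -[RHS]/(sval _ i.+1) -IH addnS.
Qed.

Lemma word_shift x n : word (shift_map x) n = behead (word x n.+1).
Proof. by rewrite -[n.+1]add1n -drop1 drop_word. Qed.

Lemma word_eqP x y n :
  word x n = word y n <-> forall i, (i < n)%N -> sval x i = sval y i.
Proof.
split=> [xy i ni|xy].
  by have := congr1 (nth (sval x i) ^~ i) xy; rewrite !nth_mkseq.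
by apply/eq_in_map => i; rewrite mem_iota /= add0n => /xy.
Qed.

Lemma word_take_eq x y n k : (n <= k)%N -> word x k = word y k -> word x n = word y n.
Proof. by move=> nk /word_eqP xy; apply/word_eqP => i /leq_trans/(_ nk)/xy. Qed.

Lemma cylinderE n (J : n.-tuple 'I_m) : cylinder A J = [set x | word x n = J].
Proof.
apply/seteqP; split=> x /= xJ.
  apply: (@eq_from_nth _ (sval x 0%N)); rewrite ?size_word ?size_tuple // => i ni.
  by rewrite nth_mkseq // (xJ (Ordinal ni)) (tnth_nth (sval x 0%N)).
by move=> i; rewrite (tnth_nth (sval x 0%N)) -xJ nth_mkseq.
Qed.

Hypothesis hm : (2 <= m)%N.

Let m_gt1 : 1 < m%:R :> R. Proof. by rewrite ltr1n. Qed.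
Let m_gt0 : 0 < m%:R :> R. Proof. by rewrite ltr0n ltnW. Qed.

Lemma sft_dist_lt_word x y n : sft_dist R x y < m%:R ^- n -> word x n = word y n.
Proof.
rewrite /sft_dist /seq_dist => dxy; apply/word_eqP => i ni.
apply/eqP/negPn/negP => xyi; move: dxy.
case: pselect => [ex|[]]; last by exists i.
case: ex_minnP => k _ /(_ i xyi) ki.
rewrite ltNge => /negP; apply.
by rewrite lef_pV2 ?posrE ?exprn_gt0 // ler_eXn2l // (leq_ltn_trans ki).
Qed.

Lemma word_sft_dist_le x y n :
  word x n = word y n -> sft_dist R x y <= m%:R ^- n.+1.
Proof.
move=> /word_eqP xy; rewrite /sft_dist /seq_dist.
case: pselect => [ex|_]; last by rewrite invr_ge0 exprn_ge0 // ltW.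
case: ex_minnP => k xyk _; rewrite lef_pV2 ?posrE ?exprn_gt0 // ler_eXn2l //.
by rewrite ltnS leqNgt; apply/negP => /xy /eqP; rewrite (negbTE xyk).
Qed.

Variable ne : [set: sft A] !=set0.
Notation X := (borel_sft R ne).

(** Every set determined by finitely many letters has this form.  The predicate
    [P] on words turns measures of such sets into finite sums. *)
Definition clopen n (P : pred (seq 'I_m)) : set X := [set x : sft A | P (word x n)].

Lemma measurable_clopen n P : measurable (clopen n P).
Proof.
apply: sub_sigma_algebra => x Px; exists (m%:R ^- n).
  by rewrite invr_gt0 exprn_gt0.
by move=> y /sft_dist_lt_word xy; rewrite /clopen /= -xy.
Qed.
#[local] Hint Resolve measurable_clopen : core.

(** The union is increasing: a point of [U] enters it at the length from which on
    its cylinders are contained in [U]. *)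
Lemma sft_open_bigcup_clopen (U : set X) : sft_open R U ->
  U = \bigcup_n clopen n (fun s => `[< forall y, word y n = s -> U y >]).
Proof.
move=> oU; apply/seteqP; split=> x.
  move=> /oU [e e0 xU].
  have [n ne'] : exists n, (m%:R ^- n.+1 : R) < e.
    exists (Num.Def.archi_bound e^-1); set n := Num.Def.archi_bound _.
    have en : e^-1 < n%:R by apply: archi_boundP; rewrite invr_ge0 ltW.
    rewrite invf_plt ?posrE ?exprn_gt0 // (lt_le_trans en) // -natrX ler_nat.
    by rewrite ltnW // (leq_trans (ltn_expl n hm)) // leq_pexp2l // ltnW.
  exists n => //; apply/asboolP => y /esym/word_sft_dist_le xy.
  by apply: xU; rewrite (le_lt_trans xy).
by move=> [n _ /asboolP]; apply.
Qed.

Lemma measurable_shift : measurable_fun setT (@shift_map m A : X -> X).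
Proof.
apply: (measurability (sft_open R (A := A) : set (set X))) => //.
move=> _ [U oU <-]; rewrite setTI (sft_open_bigcup_clopen oU) preimage_bigcup.
apply: bigcupT_measurable => n.
suff -> : @shift_map m A @^-1` (clopen n (fun s => `[< forall y, word y n = s -> U y >]))
   = clopen n.+1 (fun s => `[< forall y, word y n = behead s -> U y >]) by [].
by apply/seteqP; split => x; rewrite /clopen /= word_shift.
Qed.

End ShiftSpace.
Arguments clopen {R m A ne} n P.
Arguments measurable_shift {R m A} hm ne.

Section MeasureOfClopen.
Variables (R : realType) (m : nat) (A : 'M[nat]_m) (hm : (2 <= m)%N).
Variable ne : [set: sft A] !=set0.
Notation X := (borel_sft R ne).
Notation clopenX := (@clopen R m A ne).
Implicit Types (n : nat) (P : pred (seq 'I_m)).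



Let mclopen n P : measurable (clopenX n P). Proof. exact: measurable_clopen. Qed.
#[local] Hint Resolve mclopen : core.

Lemma measure_clopen (mu : {measure set X -> \bar R}) (p : seq 'I_m -> R) :
  (forall s, mu (clopenX (size s) (pred1 s)) = (p s)%:E) ->
  forall n P, mu (clopenX n P) = (wsum n (fun s => (P s)%:R * p s))%:E.
Proof.
move=> mup n P.
have -> : clopenX n P = \bigcup_(J in [set` [pred J : n.-tuple 'I_m | P J]])
    clopenX n (pred1 (J : seq _)).
  apply/seteqP; split => x; rewrite /clopen /=.
    move=> Px; exists (tcast (size_word x n) (in_tuple (word x n))).
      by rewrite /= inE val_tcast.
    by rewrite /= val_tcast.
  by move=> [J]; rewrite /= inE => PJ /eqP ->.
rewrite measure_fin_bigcup //=; last first.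
  apply/trivIsetP => I J _ _ IJ; apply/seteqP; split=> // x.
  rewrite /clopen /= => -[/eqP -> /eqP /val_inj IJ'].
  by rewrite IJ' eqxx in IJ.
rewrite -(@bigfs _ _ _ _ (index_enum (n.-tuple 'I_m))) ?index_enum_uniq //; last first.
  by move=> i; rewrite mem_index_enum.
rewrite wsumE big_mkcond /= -sumEFin; apply: eq_bigr => J _.
by have := mup J; rewrite size_tuple => ->; case: (P J); rewrite ?mul1r ?mul0r.
Qed.

Lemma measure_setD_bigcup_lt (mu : {measure set X -> \bar R}) (F : nat -> set X) (e : R) :
  (mu setT < +oo)%E -> (forall n, measurable (F n)) -> nondecreasing_seq F -> 0 < e ->
  exists n, (mu ((\bigcup_n F n) `\` F n) < e%:E)%E.
Proof.
move=> muT mF ndF e0.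
have mU : measurable (\bigcup_n F n) by exact: bigcupT_measurable.
have mD n : measurable (\bigcup_n F n `\` F n) by exact: measurableD.
have fin B : measurable B -> mu B \is a fin_num.
  move=> mB; rewrite ge0_fin_numE // (le_lt_trans _ muT) // le_measure ?inE //.
have : mu \o (fun n => \bigcup_n F n `\` F n) @ \oo --> mu (\bigcap_n (\bigcup_n F n `\` F n)).
  apply: nonincreasing_cvg_mu => //.
  - by rewrite -ge0_fin_numE // fin.
  - exact: bigcapT_measurable.
  - by move=> i j ij; apply/subsetPset; apply: setDS; apply/subsetPset/ndF.
have -> : \bigcap_n (\bigcup_n F n `\` F n) = set0.
  rewrite -subset0 => x h; have [[n _ Fn] _] := h 0%N Logic.I.
  by have [_] := h n Logic.I.
rewrite measure0 => /fine_cvgP[_ /cvgr_lt /(_ _ e0)[n _ h]].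
by exists n; rewrite -(fineK (fin _ (mD n))) lte_fin; apply: h => /=.
Qed.

(** The sets that clopen sets approximate in measure form a sigma-algebra:
    complements are clear, and a countable union is approximated by a finite
    one. *)
Lemma approximation_by_clopen (mu : {measure set X -> \bar R}) :
  (mu setT < +oo)%E -> forall B : set X, measurable B ->
  forall e : R, 0 < e -> exists n P,
    (mu (B `\` clopenX n P) < e%:E)%E /\ (mu (clopenX n P `\` B) < e%:E)%E.
Proof.
move=> muT.
have le_mu (B C : set X) : measurable B -> measurable C -> B `<=` C -> (mu B <= mu C)%E.
  by move=> mB mC BC; rewrite le_measure ?inE.
pose approx (B : set X) := forall e : R, 0 < e -> exists n P,
  (mu (B `\` clopenX n P) < e%:E)%E /\ (mu (clopenX n P `\` B) < e%:E)%E.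
have approxU B C : measurable B -> measurable C -> approx B -> approx C -> approx (B `|` C).
  move=> mB mC aB aC e e0.
  have e20 : 0 < e / 2 by rewrite divr_gt0.
  have [n [P [B1 B2]]] := aB _ e20; have [k [Q [C1 C2]]] := aC _ e20.
  exists (n + k)%N, (fun s => P (take n s) || Q (take k s)).
  have -> : clopenX (n + k) (fun s => P (take n s) || Q (take k s)) =
      clopenX n P `|` clopenX k Q.
    apply/seteqP; split=> x; rewrite /clopen /= take_word addnC take_word.
      by move=> /orP.
    by move=> h; apply/orP.
  rewrite (splitr e) EFinD; split.
    apply: le_lt_trans (lteD B1 C1); apply: le_trans (measureU2 _ _ _).
    - apply: le_mu.
      + by apply: measurableD; apply: measurableU.
      + by apply: measurableU; apply: measurableD.
      + by move=> x [[Bx|Cx]] /not_orP[]; [left|right].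
    - exact: measurableD.
    - exact: measurableD.
  apply: le_lt_trans (lteD B2 C2); apply: le_trans (measureU2 _ _ _).
  - apply: le_mu.
    + by apply: measurableD; apply: measurableU.
    + by apply: measurableU; apply: measurableD.
    + by move=> x [[Bx|Cx]] /not_orP[]; [left|right].
  - exact: measurableD.
  - exact: measurableD.
have lim_approx F : (forall n, measurable (F n)) -> nondecreasing_seq F ->
    (forall n, approx (F n)) -> approx (\bigcup_n F n).
  move=> mF ndF aF e e0.
  have mU : measurable (\bigcup_n F n) by exact: bigcupT_measurable.
  have e20 : 0 < e / 2 by rewrite divr_gt0.
  have [N hN] := measure_setD_bigcup_lt muT mF ndF e20.
  have [n [P [h1 h2]]] := aF N _ e20.
  exists n, P; split.
    rewrite (splitr e) EFinD; apply: le_lt_trans (lteD hN h1).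
    apply: le_trans (measureU2 _ _ _); last 2 first.
    - exact: measurableD.
    - exact: measurableD.
    apply: le_mu; [exact: measurableD|by apply: measurableU; apply: measurableD|].
    by move=> x [Ux nPx]; have [FN|FN] := pselect (F N x); [right|left].
  apply: le_lt_trans (lt_trans h2 _); last by rewrite lte_fin gtr_pMr ?invf_lt1 ?ltr1n.
  apply: le_mu; [exact: measurableD|exact: measurableD|].
  by move=> x [Px nU]; split=> // FN; apply: nU; exists N.
suff H : @measurable _ X `<=` [set B | measurable B /\ approx B].
  by move=> B /H[].
apply: smallest_sub; last first.
  move=> U oU; split; first exact: sub_sigma_algebra.
  rewrite (sft_open_bigcup_clopen hm oU); apply: lim_approx => //.
    move=> i j ij; apply/subsetPset => x; rewrite /clopen /=.
    by move=> /asboolP h; apply/asboolP => y /(word_take_eq ij)/h.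
  move=> n e e0; exists n, (fun s => `[< forall y, word y n = s -> U y >]).
  by rewrite setDv measure0 lte_fin.
split.
- split=> // e e0; exists 0%N, xpred0.
  rewrite set0D measure0 lte_fin; split=> //.
  by rewrite (_ : _ `\` _ = set0) ?measure0 ?lte_fin // -subset0 => x [].
- move=> B [mB aB]; rewrite setTD; split; first exact: measurableC.
  move=> e e0; have [n [P [h1 h2]]] := aB e e0.
  exists n, (predC P).
  have -> : clopenX n (predC P) = ~` clopenX n P.
    by apply/seteqP; split => x; rewrite /clopen /= => /negP.
  rewrite !setDE !setCK setIC -setDE; split=> //.
  by rewrite setIC -setDE.
- move=> F FG; split; first by apply: bigcupT_measurable => n; have [] := FG n.
  have -> : \bigcup_k F k = \bigcup_n \big[setU/set0]_(i < n.+1) F i.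
    apply/seteqP; split=> x [n _].
      by exists n => //; rewrite big_ord_recr; right.
    by rewrite -bigcup_mkord => -[i _ Fi]; exists i.
  apply: lim_approx => [n|i j ij|n].
  - by apply: bigsetU_measurable => i _; have [] := FG i.
  - by apply/subsetPset; apply: subset_bigsetU.
  - elim: n => [|n IH]; rewrite big_ord_recr /=.
      by rewrite big_ord0 set0U; have [] := FG 0%N.
    have [mF aF] := FG n.+1.
    apply: approxU => //.
    by apply: bigsetU_measurable => i _; have [] := FG i.
Qed.

(** Comparison on clopen sets passes to Borel sets: a Borel set is approximated
    simultaneously for both measures, through their sum. *)
Lemma le_measure_of_clopen (mu nu : {measure set X -> \bar R}) (c : R) :
  (mu setT < +oo)%E -> (nu setT < +oo)%E -> 0 < c ->
  (forall n P, nu (clopenX n P) <= c%:E * mu (clopenX n P))%E ->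
  forall B : set X, measurable B -> (nu B <= c%:E * mu B)%E.
Proof.
move=> muT nuT c0 nu_mu B mB.
have le_mu (la : {measure set X -> \bar R}) (C D : set X) :
    measurable C -> measurable D -> C `<=` D -> (la C <= la D)%E.
  by move=> mC mD CD; rewrite le_measure ?inE.
pose la : {measure set X -> \bar R} := measure_add mu nu.
have laE C : la C = (mu C + nu C)%E by exact: measure_addE.
have laT : (la setT < +oo)%E by rewrite laE lte_add_pinfty.
apply/lee_addgt0Pr => e e0.
pose e' := e / (c + 1).
have e'0 : 0 < e' by rewrite divr_gt0 // addr_gt0.
have [n [P [h1 h2]]] := approximation_by_clopen laT mB e'0.
rewrite !laE in h1 h2.
have nuD : (nu (B `\` clopenX n P) <= e'%:E)%E.
  by apply/ltW/(le_lt_trans _ h1); rewrite leeDr.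
have muD : (mu (clopenX n P `\` B) <= e'%:E)%E.
  by apply/ltW/(le_lt_trans _ h2); rewrite leeDl.
have mD1 : measurable (B `\` clopenX n P) by exact: measurableD.
have mD2 : measurable (clopenX n P `\` B) by exact: measurableD.
have nuB : (nu B <= nu (B `\` clopenX n P) + nu (clopenX n P))%E.
  apply: le_trans (measureU2 _ _ _) => //; apply: le_mu => //; first exact: measurableU.
  by move=> x Bx; have [?|?] := pselect (clopenX n P x); [right|left].
have muP : (mu (clopenX n P) <= mu (clopenX n P `\` B) + mu B)%E.
  apply: le_trans (measureU2 _ _ _) => //; apply: le_mu => //; first exact: measurableU.
  by move=> x Px; have [?|?] := pselect (B x); [right|left].
apply: (le_trans nuB); apply: (@le_trans _ _ (e'%:E + c%:E * (e'%:E + mu B))%E).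
  apply: leeD => //; apply: (le_trans (nu_mu n P)).
  by rewrite lee_pmul2l ?lte_fin // (le_trans muP) // leeD.
rewrite ge0_muleDr ?lee_fin ?(ltW e'0) // addeCA addeA -EFinM addeC leeD2l //.
have ce' : (c + 1) * e' = e by rewrite /e' mulrC divfK // gt_eqF // addr_gt0.
by rewrite -EFinD lee_fin -[leRHS]ce'; lra.
Qed.

End MeasureOfClopen.

(** * The measure on the subshift defined by a consistent function on words *)

Section Subdivision.
Variables (R : realType) (m : nat) (F : 'I_m -> R).
Hypothesis F0 : forall a, 0 <= F a.

Let cumul k : R := \sum_(b : 'I_m | (b < k)%N) F b.

Let cumulS (a : 'I_m) : cumul a.+1 = cumul a + F a.
Proof.
rewrite /cumul (bigD1 a) //= addrC; congr (_ + _); apply: eq_bigl => b.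
by rewrite ltnS ltn_neqAle andbC; congr (_ && _); apply/eqP/eqP => [->|/val_inj].
Qed.

Let cumul_mono j k : (j <= k)%N -> cumul j <= cumul k.
Proof.
move=> jk; rewrite /cumul [leRHS](bigID (fun b : 'I_m => b < j)%N) /=.
rewrite (eq_bigl (fun b : 'I_m => (b < k) && (b < j)))%N; last first.
  by move=> b; rewrite andb_idl // => /leq_trans; apply.
by rewrite lerDl sumr_ge0.
Qed.

(** The interval [0, \sum_a F a[ is cut, from left to right, into slots of
    lengths [F a]. *)
Definition slot_start (a : 'I_m) : R := \sum_(b : 'I_m | (b < a)%N) F b.

Definition slot (a : 'I_m) (r : R) : bool := slot_start a <= r < slot_start a + F a.

Lemma slot_exists r : 0 <= r < \sum_a F a -> exists a, slot a r.
Proof.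
move=> /andP[r0 rF].
have Em : cumul m = \sum_a F a by apply: eq_bigl => b; rewrite ltn_ord.
have ex : exists k, r < cumul k by exists m; rewrite Em.
case: (ex_minnP ex) => -[|k] rk mink.
  by move: rk; rewrite /cumul big_pred0 // ltNge r0.
have km : (k < m)%N.
  rewrite ltnNge; apply/negP => mk.
  have := mink m; rewrite Em => /(_ rF); rewrite leqNgt => /negP; apply.
  by rewrite ltnS.
exists (Ordinal km); rewrite /slot -[slot_start _]/(cumul (Ordinal km)) -cumulS /= rk.
by rewrite andbT leNgt; apply/negP => /mink; rewrite ltnn.
Qed.

Lemma slot_inj r a b : slot a r -> slot b r -> a = b.
Proof.
rewrite /slot -![slot_start _]/(cumul _) -!cumulS => /andP[a1 a2] /andP[b1 b2].
apply/val_inj/eqP; rewrite eqn_leq; apply/andP; split; rewrite leqNgt; apply/negP => ab.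
  by have := le_trans (cumul_mono ab) a1; rewrite leNgt b2.
by have := le_trans (cumul_mono ab) b1; rewrite leNgt a2.
Qed.

Lemma slot_bounds a r : slot a r -> 0 <= r < \sum_b F b.
Proof.
move=> /andP[h1 h2]; apply/andP; split.
  by apply: le_trans h1; apply: sumr_ge0.
apply: (lt_le_trans h2); rewrite -[slot_start _]/(cumul _) -cumulS.
have -> : \sum_a F a = cumul m by apply: eq_bigl => b; rewrite ltn_ord.
exact: cumul_mono.
Qed.

End Subdivision.

Section Coding.
Variables (R : realType) (m : nat) (A : 'M[nat]_m) (hm : (2 <= m)%N).
Variable ne : [set: sft A] !=set0.
Notation X := (borel_sft R ne).
Notation clopenX := (@clopen R m A ne).
Implicit Types (s : seq 'I_m) (t r : R).

Variable p : seq 'I_m -> R.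
Hypothesis p_ge0 : forall s, 0 <= p s.
Hypothesis p_nil : p [::] = 1.
Hypothesis p_rcons : forall s, p s = \sum_a p (rcons s a).
Hypothesis p_adm : forall s, 0 < p s -> sorted (fun i j => A i j == 1%N) s.

Let x0 : sft A := sval (cid ne).

Let a0 : 'I_m := sval x0 0%N.

Let children s (a : 'I_m) : R := p (rcons s a).

Let children_ge0 s a : 0 <= children s a.
Proof. exact: p_ge0. Qed.

(** A point of the unit interval is coded like in a numeration system: the state
    is the word read so far together with the position relative to the left end
    of the interval of that word. *)
Let step (z : seq 'I_m * R) : seq 'I_m * R :=
  let a := odflt a0 [pick a | slot (children z.1) a z.2] in
  (rcons z.1 a, z.2 - slot_start (children z.1) a).

Let code t n := iter n step ([::], t).

Let size_code t n : size (code t n).1 = n.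
Proof. by elim: n => //= n IH; rewrite size_rcons IH. Qed.

(** By induction on [s]: appending a letter selects a slot of the interval already
    obtained, and the second component of the state is the position in it. *)
Let code_interval s : exists l, forall t,
  (0 <= t < 1 /\ (code t (size s)).1 = s <-> l <= t < l + p s) /\
  (0 <= t < 1 /\ (code t (size s)).1 = s -> (code t (size s)).2 = t - l).
Proof.
elim/last_ind: s => [|s a [l IH]].
  exists 0 => t; rewrite p_nil add0r subr0 /=; split; last by [].
  by split=> [[]|].
exists (l + slot_start (children s) a) => t; rewrite size_rcons.
have step_eq : (code t (size s).+1).1 = rcons s a <->
    (code t (size s)).1 = s /\
    odflt a0 [pick b | slot (children s) b (code t (size s)).2] = a.
  rewrite /code iterS -/(code t (size s)) /=; split.
    by move=> /rcons_inj [e1]; rewrite e1.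
  by move=> [-> ->].
have [IH1 IH2] := IH t.
have slotE : l <= t < l + p s ->
    (odflt a0 [pick b | slot (children s) b (t - l)] = a <-> slot (children s) a (t - l)).
  move=> ht; split.
    case: pickP => [b hb <- //|none].
    have [b hb] : exists b, slot (children s) b (t - l).
      apply: slot_exists; rewrite -[\sum_a _]p_rcons; move: ht; lra.
    by rewrite none in hb.
  move=> ha; case: pickP => [b hb|/(_ a)]; last by rewrite ha.
  exact: slot_inj hb ha.
have slot_in : slot (children s) a (t - l) -> l <= t < l + p s.
  move=> /slot_bounds /=; rewrite -[\sum_a _]p_rcons => h; have := h (fun b => p_ge0 _); lra.
have slot_itv : slot (children s) a (t - l) <->
   l + slot_start (children s) a <= t < l + slot_start (children s) a + p (rcons s a).
  by rewrite /slot /children; split; lra.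
split.
- split.
  + move=> [t01 /step_eq[cs oa]].
    apply/slot_itv/slotE; first exact/IH1.
    by rewrite -(IH2 (conj t01 cs)).
  + move=> /slot_itv ht; have hl := slot_in ht; have [t01 cs] := IH1.2 hl.
    split=> //; apply/step_eq; split=> //.
    by rewrite IH2 //; apply/slotE.
- move=> [t01 /step_eq[cs oa]].
  by rewrite /code iterS -/(code t (size s)) /= cs oa IH2 // opprD addrA.
Qed.

Let digits t : full_shift m := fun k => nth a0 (code t k.+1).1 k.

Let mkseq_digits t n : mkseq (digits t) n = (code t n).1.
Proof.
elim: n => [//|n IH]; rewrite mkseqS IH {2}/code iterS -/(code t n) /=.
congr rcons; rewrite /digits /code iterS -/(code t n) /=.
by rewrite nth_rcons size_code ltnn eqxx.
Qed.

Let digits_adm t : 0 <= t < 1 -> Sigma_A A (digits t).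
Proof.
move=> t01 k.
have : sorted (fun i j => A i j == 1%N) (code t k.+2).1.
  apply: p_adm; have [l /(_ t)[[h _] _]] := code_interval (code t k.+2).1.
  by have := h; rewrite size_code => /(_ (conj t01 erefl)); lra.
rewrite -mkseq_digits => /(sortedP (digits t 0%N)) /(_ k).
by rewrite size_mkseq ltnS leqnn !nth_mkseq // => /(_ isT)/eqP.
Qed.

Let coding t : sft A :=
  if pselect (0 <= t < 1) is left t01 then exist _ (digits t) (digits_adm t01) else x0.

Let word_coding t n : 0 <= t < 1 -> word (coding t) n = (code t n).1.
Proof. by move=> t01; rewrite /coding; case: pselect => // ?; exact: mkseq_digits. Qed.

Let I01 : set (measurableTypeR R) := `[0, 1[%classic.

Let mI01 : measurable I01. Proof. exact: measurable_itv. Qed.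

Let preimage_cylinder s : exists l,
  I01 `&` coding @^-1` (clopenX (size s) (pred1 s)) = `[l, l + p s[%classic.
Proof.
have [l hl] := code_interval s; exists l; apply/seteqP; split=> t.
  move=> [It]; rewrite /clopen /=; rewrite /I01 /= in_itv /= in It.
  by rewrite word_coding // in_itv /= => /eqP cs; apply/(hl t).1.
rewrite /= in_itv /= => /(hl t).1 [t01 cs].
by split; rewrite /I01 /clopen /= ?in_itv //= word_coding // cs.
Qed.

Let measurable_coding : measurable_fun setT (coding : measurableTypeR R -> X).
Proof.
rewrite -(setUv I01); apply/measurable_funU => //; first exact: measurableC.
split; last first.
  apply: (eq_measurable_fun (fun=> x0 : X)); last exact: measurable_cst.
  move=> t; rewrite inE /I01 /coding /= in_itv /= => nt.
  by case: pselect.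
apply: (measurability (sft_open R (A := A) : set (set X))) => //.
move=> _ [U oU <-]; rewrite (sft_open_bigcup_clopen hm oU) preimage_bigcup setI_bigcupr.
apply: bigcupT_measurable => n; set P := fun s => _; clearbody P.
have -> : I01 `&` coding @^-1` clopenX n P =
   \bigcup_(J in [set` [pred J : n.-tuple 'I_m | P J]])
     (I01 `&` coding @^-1` clopenX (size (J : seq _)) (pred1 (J : seq _))).
  apply/seteqP; split=> t.
    move=> [It]; rewrite /clopen /= => Pt.
    exists (tcast (size_word (coding t) n) (in_tuple (word (coding t) n))).
      by rewrite /= inE val_tcast.
    by rewrite val_tcast; split=> //=; rewrite size_word.
  move=> [J]; rewrite /= inE => PJ [It]; rewrite /clopen /= size_tuple => /eqP ->.
  by split.
apply: fin_bigcup_measurable => [|J _]; first exact: finite_finpred.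
by have [l ->] := preimage_cylinder J; exact: measurable_itv.
Qed.

(** As an image of Lebesgue measure, the set function is countably additive for
    free: only the preimages of cylinders have to be computed. *)
Lemma measure_of_words : exists mu : probability X R,
  forall s, mu (clopenX (size s) (pred1 s)) = (p s)%:E.
Proof.
pose la0 := mrestr (@lebesgue_measure R) mI01.
have la01 : la0 setT = 1%E.
  by rewrite /la0 /mrestr setTI lebesgue_measure_itv /= lte01 sube0.
pose la : probability (measurableTypeR R) R :=
  HB.pack la0 (Measure_isProbability.Build _ _ _ la0 la01).
pose T : {mfun measurableTypeR R >-> X} :=
  HB.pack coding (isMeasurableFun.Build _ _ _ _ _ measurable_coding).
exists (distribution la T) => s.
rewrite /distribution /pushforward /= /la0 /mrestr setIC.
have [l ->] := preimage_cylinder s.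
rewrite lebesgue_measure_itv /= lte_fin ltrDl; case: ltP => [_|p_le0].
  by rewrite -EFinB addrC addKr.
by congr EFin; apply/le_anti; rewrite p_ge0.
Qed.

End Coding.

(** * Ergodicity, and uniqueness within a measure class *)

Section InvariantIterates.
Context d (T : measurableType d) (R : realType).
Variables (mu : probability T R) (f : T -> T).
Hypothesis mf : measurable_fun setT f.
Hypothesis mu_inv : forall B, measurable B -> mu (f @^-1` B) = mu B.

Let mpre B : measurable B -> measurable (f @^-1` B).
Proof. by move=> mB; rewrite -[X in measurable X]setTI; exact: mf. Qed.

Lemma measurable_preimage_iter k B : measurable B -> measurable (iter k f @^-1` B).
Proof.
elim: k B => [//|k IH] B mB.
by rewrite (_ : _ @^-1` B = iter k f @^-1` (f @^-1` B)) //; exact/IH/mpre.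
Qed.

Lemma invariant_iter k B : measurable B -> mu (iter k f @^-1` B) = mu B.
Proof.
elim: k B => [//|k IH] B mB.
rewrite (_ : iter k.+1 f @^-1` B = iter k f @^-1` (f @^-1` B)) // IH ?mu_inv //.
exact: mpre.
Qed.

End InvariantIterates.

Section AbsolutelyContinuous.
Context d (T : measurableType d) (R : realType).
Variables (mu nu : probability T R) (f : T -> T).
Hypothesis mf : measurable_fun setT f.
Hypothesis mu_inv : forall B, measurable B -> mu (f @^-1` B) = mu B.
Hypothesis nu_inv : forall B, measurable B -> nu (f @^-1` B) = nu B.

(** Quantifying over subsets makes the property stable under countable unions. *)
Let balanced (C : set T) :=
  forall D, measurable D -> D `<=` C -> nu D = mu D.

Let balanced_bigcup (C : nat -> set T) :
  (forall k, measurable (C k)) -> (forall k, balanced (C k)) -> balanced (\bigcup_k C k).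
Proof.
move=> mC bC D mD DC.
have -> : D = \bigcup_k seqDU (fun k => D `&` C k) k.
  by rewrite -seqDU_bigcup_eq -setI_bigcupr; apply/esym/setIidPl.
have mDC k : measurable (seqDU (fun k => D `&` C k) k).
  by apply: measurableD; [exact: measurableI|apply: bigsetU_measurable => i _; exact: measurableI].
rewrite !measure_bigcup //.
apply: eq_eseriesr => k _; apply: (bC k) => //.
by apply: (subset_trans (@subset_seqDU _ _ k)); exact: subIsetr.
Qed.

(** Let [P] be a positive set of a Hahn decomposition for [nu - mu], and [Q] its
    preimage under an iterate of [f].  By invariance [nu - mu] takes the same value
    on [P] and [Q], hence also on [P `\` Q], where it is nonnegative, and on
    [Q `\` P], where it is nonpositive; so it vanishes on both.  Therefore [P] may
    be replaced by the limsup [W] of its preimages, which is strictly invariant.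
    If [mu W = 0] then [nu W = 0] by absolute continuity, and if [mu W = 1] then
    [nu W <= mu W]; in both cases the positive part of [nu - mu] is zero, and so
    is the negative part because the total masses agree. *)
Lemma ergodic_absolutely_continuous_eq :
  (forall B, measurable B -> f @^-1` B = B -> mu B = 0%E \/ mu B = 1%E) ->
  (forall B, measurable B -> mu B = 0%E -> nu B = 0%E) ->
  forall B, measurable B -> nu B = mu B.
Proof.
move=> mu_erg nu_ac.
pose m B := fine (mu B); pose n B := fine (nu B).
have mE B : measurable B -> mu B = (m B)%:E by move=> ?; rewrite fineK ?fin_num_measure.
have nE B : measurable B -> nu B = (n B)%:E by move=> ?; rewrite fineK ?fin_num_measure.
pose ch : {charge set T -> \bar R} :=
  cadd (charge_of_finite_measure nu) (copp (charge_of_finite_measure mu)).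
have chE B : measurable B -> ch B = (n B - m B)%:E.
  move=> mB; rewrite /ch /= /cadd /copp /charge_of_finite_measure /=.
  by rewrite EFinB -mE // -nE.
have [P [N [[mP posP] [mN negN] PN0 PN1]]] := Hahn_decomposition ch.
have NE : N = ~` P.
  apply/seteqP; split=> x.
    by move=> Nx Px; have : (P `&` N) x by []; rewrite PN1.
  by move=> nPx; have : (P `|` N) x by [rewrite PN0]; case.
have mn_pos B : measurable B -> B `<=` P -> m B <= n B.
  by move=> mB BP; have := posP B mB BP; rewrite chE // lee_fin subr_ge0.
have mn_neg B : measurable B -> B `<=` ~` P -> n B <= m B.
  by move=> mB BP; have := negN B mB; rewrite NE chE // lee_fin subr_le0; apply.
have mD B C : measurable B -> measurable C -> m B = m (B `\` C) + m (B `&` C).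
  move=> mB mC; apply: EFin_inj; rewrite EFinD -!mE ?(measureDI mu mB mC) //.
    exact: measurableI.
  exact: measurableD.
have nD B C : measurable B -> measurable C -> n B = n (B `\` C) + n (B `&` C).
  move=> mB mC; apply: EFin_inj; rewrite EFinD -!nE ?(measureDI nu mB mC) //.
    exact: measurableI.
  exact: measurableD.
have balancedP C : measurable C -> n C = m C -> (C `<=` P \/ C `<=` ~` P) -> balanced C.
  move=> mC eC hC D mD' DC.
  rewrite nE // mE //; congr EFin.
  have h1 := mD C D mC mD'; have h2 := nD C D mC mD'.
  rewrite (setIidr DC) in h1; rewrite (setIidr DC) in h2.
  have mCD : measurable (C `\` D) by exact: measurableD.
  have CDC : C `\` D `<=` C by move=> x [].
  case: hC => hC.
    have := mn_pos _ mCD (subset_trans CDC hC).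
    have := mn_pos _ mD' (subset_trans DC hC); lra.
  have := mn_neg _ mCD (subset_trans CDC hC).
  have := mn_neg _ mD' (subset_trans DC hC); lra.
pose Q k := iter k f @^-1` P.
have mQ k : measurable (Q k) by exact: measurable_preimage_iter.
have mu_Q k : m (Q k) = m P by rewrite /m (invariant_iter mf mu_inv).
have nu_Q k : n (Q k) = n P by rewrite /n (invariant_iter mf nu_inv).
have QP k : balanced (Q k `\` P) /\ balanced (P `\` Q k).
  have mQP : measurable (Q k `\` P) by exact: measurableD.
  have mPQ : measurable (P `\` Q k) by exact: measurableD.
  have sQP : Q k `\` P `<=` ~` P by move=> x [].
  have sPQ : P `\` Q k `<=` P by move=> x [].
  have q1 := mD _ _ (mQ k) mP; have q2 := nD _ _ (mQ k) mP.
  have p1 := mD _ _ mP (mQ k); have p2 := nD _ _ mP (mQ k).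
  rewrite setIC in p1; rewrite setIC in p2.
  have := mu_Q k; have := nu_Q k.
  have := mn_neg _ mQP sQP; have := mn_pos _ mPQ sPQ => *.
  split; apply: balancedP => //; [lra|by right|lra|by left].
pose W := lim_sup_set Q.
have mW : measurable W.
  by apply: bigcap_measurable => // k _; apply: bigcup_measurable => j _.
have invW : f @^-1` W = W.
  apply/seteqP; split=> x Wx k _.
    have [j /= kj Qj] := Wx k Logic.I; exists j.+1; first by rewrite /= ltnW.
    by rewrite -[Q _ x]/(P (iter j.+1 f x)) iterSr.
  have [[|j] /= kj Qj] := Wx k.+1 Logic.I; first by [].
  by exists j => //; rewrite -[_ (f x)]/(P (iter j f (f x))) -iterSr.
have bWP : balanced (W `\` P).
  move=> D mD' DW; apply: (balanced_bigcup (C := fun k => Q k `\` P)) => //.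
  - by move=> k; exact: measurableD.
  - by move=> k; have [] := QP k.
  - by move=> x /DW[Wx nPx]; have [j _ Qj] := Wx 0%N Logic.I; exists j.
have bPW : balanced (P `\` W).
  move=> D mD' DW; apply: (balanced_bigcup (C := fun k => P `\` Q k)) => //.
  - by move=> k; exact: measurableD.
  - by move=> k; have [] := QP k.
  - move=> x /DW[Px nWx]; apply: contrapT => h; apply: nWx => k _.
    exists k => //=; apply: contrapT => nQ; apply: h.
    by exists k.
have eP : n P - m P = n W - m W.
  have mWP : measurable (W `\` P) by exact: measurableD.
  have mPW : measurable (P `\` W) by exact: measurableD.
  have := congr1 fine (bWP _ mWP (@subset_refl _ _)).
  have := congr1 fine (bPW _ mPW (@subset_refl _ _)).
  rewrite -/(m _) -/(n _) -/(m _) -/(n _).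
  have := mD W P mW mP; have := nD W P mW mP.
  have := mD P W mP mW; have := nD P W mP mW.
  rewrite (setIC P W) => *; lra.
have nP0 : n P = m P.
  have := mn_pos P mP (@subset_refl _ _).
  have [W0|W1] := mu_erg W mW invW.
    have nW0 : n W = 0 by rewrite /n (nu_ac W).
    have mW0 : m W = 0 by rewrite /m W0.
    by move: eP; rewrite nW0 mW0; lra.
  have : n W <= 1 by rewrite -lee_fin -nE // probability_le1.
  have mW1 : m W = 1 by rewrite /m W1.
  by move: eP; rewrite mW1; lra.
have nN0 : n (~` P) = m (~` P).
  apply: EFin_inj; rewrite -nE -?mE ?(probability_setC _ mP) ?nE ?mE ?nP0 //; exact: measurableC.
move=> B mB; rewrite nE // mE //; congr EFin; rewrite (mD B P) // (nD B P) //.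
have bN : balanced (~` P) by apply: balancedP; [exact: measurableC|exact: nN0|right].
have bP : balanced P by apply: balancedP => //; left.
by congr (_ + _); congr fine; [apply: bN|apply: bP];
  [exact: measurableD|move=> x []|exact: measurableI|move=> x []].
Qed.

End AbsolutelyContinuous.
Section MeasureOfWords.
Variables (R : realType) (m : nat) (A : 'M[nat]_m) (hm : (2 <= m)%N).
Variable ne : [set: sft A] !=set0.
Notation X := (borel_sft R ne).
Notation clopenX := (@clopen R m A ne).
Notation sh := (@shift_map m A : X -> X).

Variables (mu : probability X R) (p : seq 'I_m -> R).
Hypothesis mu_p : forall s, mu (clopenX (size s) (pred1 s)) = (p s)%:E.

Let mclopen n P : measurable (clopenX n P). Proof. exact: measurable_clopen. Qed.
#[local] Hint Resolve mclopen : core.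

(** The measure and its image under the shift agree on clopen sets. *)
Lemma shift_invariant_of_words :
  (forall s, p s = \sum_a p (a :: s)) -> shift_invariant mu.
Proof.
move=> p_cons.
pose S : {mfun X >-> X} :=
  HB.pack sh (isMeasurableFun.Build _ _ _ _ _ (measurable_shift hm ne)).
pose mu' : probability X R := distribution mu S.
have eq_clopen n P : mu' (clopenX n P) = mu (clopenX n P).
  have -> : mu' (clopenX n P) = mu (clopenX n.+1 (fun s => P (behead s))).
    rewrite /mu' /= /distribution /pushforward /=; congr (mu _).
    by apply/seteqP; split => x; rewrite /clopen /= word_shift.
  rewrite !(measure_clopen hm mu_p) /= -wsum_sum; congr EFin; apply: eq_wsum => s _.
  by rewrite -mulr_sumr -p_cons.
move=> B mB; rewrite -[LHS]/(mu' B).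
have fin (la : probability X R) : (la setT < +oo)%E by rewrite probability_setT ltry.
apply/le_anti/andP; split.
  rewrite -[leRHS]mul1e; apply: (le_measure_of_clopen hm (fin mu) (fin mu') ltr01) => //.
  by move=> n P; rewrite mul1e; have /eqP := eq_clopen n P; rewrite eq_le => /andP[].
rewrite -[leRHS]mul1e; apply: (le_measure_of_clopen hm (fin mu') (fin mu) ltr01) => //.
by move=> n P; rewrite mul1e; have /eqP := eq_clopen n P; rewrite eq_le => /andP[].
Qed.

(** Let [F] be clopen and close to an invariant set [B].  The quasi-Bernoulli
    inequality bounds below the measure of the set of points outside [F] whose
    image under a suitable iterate of the shift is in [F]; but the complement of [B]
    never enters [B], so this measure is small. *)
Lemma ergodic_of_words (K : R) gap : shift_invariant mu -> 0 < K ->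
  (forall s t, p s * p t <= K * wsum gap (fun u => p (s ++ u ++ t))) -> ergodic mu.
Proof.
move=> mu_inv K0 mix B mB invB.
pose pr C := fine (mu C).
have muE C : measurable C -> mu C = (pr C)%:E by move=> ?; rewrite fineK ?fin_num_measure.
have le_pr C D : measurable C -> measurable D -> C `<=` D -> pr C <= pr D.
  by move=> mC mD CD; rewrite -lee_fin -!muE // le_measure ?inE.
have prU C D : measurable C -> measurable D -> pr (C `|` D) <= pr C + pr D.
  move=> mC mD; rewrite -lee_fin EFinD -!muE //; last exact: measurableU.
  exact: measureU2.
have invBk k : iter k sh @^-1` B = B.
  elim: k => [//|k IH]; rewrite -[LHS]/(iter k sh @^-1` (sh @^-1` B)).
  by rewrite -[in RHS]IH -[in RHS]invB.
set b := pr B.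
have b01 : 0 <= b <= 1.
  by rewrite -!lee_fin -muE // measure_ge0 probability_le1.
have small e : 0 < e -> b * (1 - b) <= e * (2 * K + 1).
  move=> e0.
  have [n [P [mu1 mu2]]] := approximation_by_clopen hm
    (eq_ind_r (fun x => x < +oo)%E (ltry 1) (probability_setT mu)) mB e0.
  set F := clopenX n P in mu1 mu2.
  have mF : measurable F by exact: mclopen.
  have mBF : measurable (B `\` F) by exact: measurableD.
  have mFB : measurable (F `\` B) by exact: measurableD.
  have h1 : pr (B `\` F) < e by rewrite -lte_fin -muE.
  have h2 : pr (F `\` B) < e by rewrite -lte_fin -muE.
  set f := pr F.
  have fE : f = wsum n (fun s => (P s)%:R * p s).
    by rewrite /f /pr (measure_clopen hm mu_p).
  have fCE : 1 - f = wsum n (fun s => (~~ P s)%:R * p s).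
    apply: EFin_inj; rewrite EFinB -muE // -probability_setC //.
    rewrite -(measure_clopen hm mu_p) //; congr (mu _).
    by apply/seteqP; split => x; rewrite /F /clopen /= => /negP.
  have f01 : 0 <= f <= 1.
    by rewrite -!lee_fin -muE // measure_ge0 probability_le1.
  pose N := (n + gap)%N.
  pose Q s := ~~ P (take n s) && P (drop N s).
  have QE : clopenX (N + n) Q = ~` F `&` iter N sh @^-1` F.
    apply/seteqP; split => x; rewrite /Q /F /clopen /= drop_word -addnA take_word.
      by move=> /andP[/negP].
    by move=> [/negP h1' h2']; rewrite h1' h2'.
  have lower : f * (1 - f) <= K * pr (clopenX (N + n) Q).
    rewrite /pr (measure_clopen hm mu_p) /= mulrC fCE fE wsumM /N -addnA wsumD -wsumZ.
    apply: ler_wsum => s ss; rewrite wsumD wsum_exchange -wsumZ.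
    apply: ler_wsum => t st; rewrite mulrACA.
    rewrite (@eq_wsum _ _ _ _ (fun u => (~~ P s)%:R * (P t)%:R * p (s ++ u ++ t))).
      by rewrite wsumZ [leRHS]mulrCA ler_wpM2l // -natrM ler0n.
    move=> u su; rewrite /Q take_size_cat // catA drop_size_cat ?size_cat ?ss ?su //.
    by rewrite -natrM mulnb.
  have upper : pr (clopenX (N + n) Q) <= e + e.
    have mG : measurable (iter N sh @^-1` (F `\` B)).
      by apply: measurable_preimage_iter => //; exact: measurable_shift.
    have prG : pr (iter N sh @^-1` (F `\` B)) = pr (F `\` B).
      by rewrite /pr (invariant_iter (measurable_shift hm ne)).
    rewrite (le_trans _ (lerD (ltW h1) (ltW h2))) // -prG (le_trans _ (prU _ _ _ _)) //.
    apply: le_pr => //; first exact: measurableU.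
    rewrite QE => x [nFx Fx]; have [Bx|nBx] := pselect (B x); first by left.
    right; split=> // Bx; apply: nBx; rewrite -(invBk N); exact: Bx.
  have fb : f - b <= e.
    have := prU _ _ mFB mB; rewrite -/b => h.
    have : f <= pr (F `\` B `|` B).
      apply: le_pr => //; first exact: measurableU.
      by move=> x Fx; have [Bx|nBx] := pselect (B x); [right|left].
    lra.
  have bf : b - f <= e.
    have := prU _ _ mBF mF; rewrite -/f => h.
    have : b <= pr (B `\` F `|` F).
      apply: le_pr => //; first exact: measurableU.
      by move=> x Bx; have [Fx|nFx] := pselect (F x); [right|left].
    lra.
  have step1 : f * (1 - f) <= K * (e + e) by rewrite (le_trans lower) // ler_pM2l.
  have step2 : b * (1 - b) - f * (1 - f) <= e.
    have -> : b * (1 - b) - f * (1 - f) = (b - f) * (1 - b - f) by ring.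
    have [bf0|bf0] := leP 0 (b - f).
      by rewrite (le_trans _ bf) // ler_piMr //; lra.
    have -> : (b - f) * (1 - b - f) = (f - b) * (b + f - 1) by ring.
    by rewrite (le_trans _ fb) // ler_piMr //; lra.
  by lra.
have b0 : b * (1 - b) <= 0.
  rewrite leNgt; apply/negP => h.
  have K1 : 0 < 2 * K + 1 by lra.
  have := small (b * (1 - b) / (2 * K + 1) / 2).
  rewrite !divr_gt0 // => /(_ isT).
  have -> : b * (1 - b) / (2 * K + 1) / 2 * (2 * K + 1) = b * (1 - b) / 2.
    by field; rewrite gt_eqF.
  lra.
have : b * (1 - b) == 0.
  by rewrite eq_le b0 mulr_ge0 //; lra.
rewrite mulf_eq0 => /orP[/eqP b_0|/eqP b_1]; rewrite muE // -/b; [left|right].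
  by rewrite b_0.
by congr EFin; lra.
Qed.

End MeasureOfWords.

Section GibbsUniqueness.
Variables (R : realType) (m : nat) (A : 'M[nat]_m) (hm : (2 <= m)%N).
Variable ne : [set: sft A] !=set0.
Notation X := (borel_sft R ne).
Notation clopenX := (@clopen R m A ne).

(** Domination on cylinders gives absolute continuity on Borel sets. *)
Lemma unique_of_words (mu nu : probability X R) (c : R) :
  shift_invariant mu -> ergodic mu -> shift_invariant nu -> 0 < c ->
  (forall s, nu (clopenX (size s) (pred1 s)) <= c%:E * mu (clopenX (size s) (pred1 s)))%E ->
  forall B, measurable B -> nu B = mu B.
Proof.
move=> mu_inv mu_erg nu_inv c0 nu_mu.
have words (la : probability X R) s :
    la (clopenX (size s) (pred1 s)) = (fine (la (clopenX (size s) (pred1 s))))%:E.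
  by rewrite fineK // fin_num_measure //; exact: measurable_clopen.
apply: (ergodic_absolutely_continuous_eq (measurable_shift hm ne)) => //.
move=> B mB muB; apply/eqP; rewrite eq_le measure_ge0 andbT.
have fin (la : probability X R) : (la setT < +oo)%E by rewrite probability_setT ltry.
rewrite -(mule0 c%:E) -muB; apply: (le_measure_of_clopen hm (fin mu) (fin nu) c0) => //.
move=> n P; rewrite (measure_clopen hm (words mu)) (measure_clopen hm (words nu)).
rewrite -EFinM lee_fin -wsumZ; apply: ler_wsum => s _.
rewrite mulrCA ler_wpM2l //.
by rewrite -lee_fin EFinM -!words.
Qed.

End GibbsUniqueness.

(** * Primitive matrices: words, points and connections *)

Section PrimitiveShift.
Variables (m : nat) (A : 'M[nat]_m).
Hypothesis (A01 : zero_one_mx A).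
Notation adm := (fun i j => A i j == 1%N).
Implicit Types (s t : seq 'I_m).

(** A positive entry of a power of [A] is a path, whose intermediate letters are
    the connecting word. *)
Lemma power_connect k i j : (0 < (A ^+ k.+1) i j)%N ->
  exists u, size u = k /\ path adm i (rcons u j).
Proof.
have pos (i' l : 'I_m) (b : nat) : (0 < A i' l * b)%N -> A i' l == 1%N /\ (0 < b)%N.
  by rewrite muln_gt0 => /andP[Al ->]; case: (A01 i' l) Al => ->.
elim: k i => [|k IH] i.
  by rewrite expr1 => Aij; exists [::]; rewrite /= andbT; case: (A01 i j) Aij => ->.
rewrite exprS -mulmxE mxE => Aij.
have [l /pos[Ail /IH[u [su pu]]]] : exists l, (0 < A i l * (A ^+ k.+1) l j)%N.
  apply: contrapT => h; move: Aij; rewrite big1 // => l _.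
  by apply/eqP; rewrite -leqn0 leqNgt; apply/negP => hl; apply: h; exists l.
by exists (l :: u); rewrite /= su Ail.
Qed.

Lemma primitive_gap : (2 <= m)%N -> primitive_mx A -> exists L, forall i j,
  exists u, size u = L /\ path adm i (rcons u j).
Proof.
move=> m2 [[|k] Ak]; last by exists k => i j; exact: power_connect.
have lt0 : (0 < m)%N by apply: leq_trans m2.
by have := Ak (Ordinal lt0) (Ordinal m2); rewrite expr0 mxE.
Qed.

Hypothesis next : forall i, exists j, A i j = 1%N.

Lemma word_of_point (x : sft A) n : sorted adm (word x n).
Proof.
apply/(sortedP (sval x 0%N)) => i; rewrite size_word => ni.
by rewrite !nth_mkseq // ?(ltnW ni) //; apply/eqP; exact: (svalP x).
Qed.

(** Every letter has a successor, so admissible words extend to points. *)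
Lemma point_of_word (x0 : sft A) s : sorted adm s -> exists x : sft A, word x (size s) = s.
Proof.
case: s => [_|a s]; first by exists x0.
move=> sas.
pose nxt i := sval (cid (next i)).
have nxtP i : A i (nxt i) = 1%N by rewrite /nxt; case: cid.
pose y k := if (k < size (a :: s))%N then nth a (a :: s) k
  else iter (k - size s) nxt (last a s).
have Ay : Sigma_A A y.
  move=> k; rewrite /y; case: (ltngtP k.+1 (size (a :: s))) => hk.
  - by apply/eqP; move/(sortedP a): sas; apply.
  - by rewrite subSn ?iterS //; apply: ltnW.
  - move: hk => /= -[->]; rewrite subSnn /=.
    by have := nth_last a (a :: s) => /= ->.
exists (exist _ y Ay); apply: (@eq_from_nth _ a); rewrite ?size_word // => i si.
by rewrite nth_mkseq //= /y si.
Qed.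

(** Compactness of the subshift, as Koenig's lemma. *)
Lemma sft_koenig (B : seq 'I_m -> Prop) : B [::] ->
  (forall s, B s -> exists a, B (rcons s a)) ->
  (forall s, B s -> exists x : sft A, word x (size s) = s) ->
  exists x : sft A, forall n, B (word x n).
Proof.
move=> B0 BS Bx.
pose T := {s | B s}.
pose step (s : T) : T :=
  exist B (rcons (sval s) (sval (cid (BS _ (svalP s))))) (svalP (cid (BS _ (svalP s)))).
pose z n : T := iter n step (exist B [::] B0).
have sz n : size (sval (z n)) = n by elim: n => //= n IH; rewrite size_rcons IH.
have [a _] := BS _ B0.
pose y k := nth a (sval (z k.+1)) k.
have yz n : mkseq y n = sval (z n).
  elim: n => [//|n IH]; rewrite mkseqS IH /y /= nth_rcons sz ltnn eqxx //.
have Ay : Sigma_A A y.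
  move=> k; have [x hx] := Bx _ (svalP (z k.+2)).
  rewrite sz -yz in hx.
  have e i : (i < k.+2)%N -> sval x i = y i.
    by move=> ik; rewrite -(nth_mkseq a (sval x) ik) -(nth_mkseq a y ik); congr nth.
  by rewrite -!e //; exact: (svalP x).
exists (exist _ y Ay) => n; rewrite [word _ _]yz; exact: svalP.
Qed.

End PrimitiveShift.

(** * Products of positive matrices along orbits *)

Lemma finite_positive_lower_bound (R : realType) (T : finType) (f : T -> R) :
  (forall a, 0 < f a) -> exists2 c, 0 < c & forall a, c <= f a.
Proof.
move=> f0; exists (\big[Num.min/1]_a f a).
  by elim/big_ind: _ => // x y x0 y0; rewrite lt_min x0.
by move=> a; rewrite (bigD1 a) //= ge_min lexx.
Qed.

Section EntryNorm.
Variables (R : realType) (d : nat).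
Implicit Types B C : 'M[R]_d.

Definition row_sum B i := \sum_j B i j.

Lemma row_sumM B C i : row_sum (B * C) i = \sum_k B i k * row_sum C k.
Proof.
rewrite /row_sum; under eq_bigr do rewrite -mulmxE mxE.
by rewrite exchange_big /=; apply: eq_bigr => k _; rewrite mulr_sumr.
Qed.

Lemma row_sum1 i : row_sum (1 : 'M[R]_d) i = 1.
Proof.
rewrite /row_sum (bigD1 i) //= mxE eqxx big1 ?addr0 // => j ji.
by rewrite mxE eq_sym (negbTE ji).
Qed.

Lemma entry_normM B C :
  entry_norm (B * C) = \sum_k (\sum_i B i k) * row_sum C k.
Proof.
rewrite /entry_norm; under eq_bigr do rewrite -/(row_sum _ _) row_sumM.
by rewrite exchange_big /=; apply: eq_bigr => k _; rewrite mulr_suml.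
Qed.

Lemma entry_norm_submult B C : (forall i j, 0 <= B i j) -> (forall i j, 0 <= C i j) ->
  entry_norm (B * C) <= entry_norm B * entry_norm C.
Proof.
move=> B0 C0; rewrite entry_normM /entry_norm [X in _ <= X * _]exchange_big mulr_suml /=.
apply: ler_sum => k _; rewrite ler_wpM2l ?sumr_ge0 //.
by rewrite [leRHS](bigD1 k) //= lerDl sumr_ge0 // => i _; apply: sumr_ge0.
Qed.

(** The norm of the product pairs the column sums of [B] with the row sums of
    [C]; if the latter are comparable, each is a fixed fraction of the norm of
    [C]. *)
Lemma entry_norm_supermult B C (kappa : R) : (forall i j, 0 <= B i j) ->
  (forall i k, row_sum C i <= kappa * row_sum C k) ->
  entry_norm B * entry_norm C <= d%:R * kappa * entry_norm (B * C).
Proof.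
move=> B0 hC; rewrite entry_normM /entry_norm [X in X * _ <= _]exchange_big /=.
rewrite mulr_suml mulr_sumr; apply: ler_sum => k _.
rewrite mulrCA ler_wpM2l ?sumr_ge0 // -mulrA.
rewrite (le_trans (ler_sum _ (fun i _ => hC i k))) // sumr_const card_ord.
by rewrite mulr_natl.
Qed.

End EntryNorm.

Section PositiveCocycle.
Variables (R : realType) (m : nat) (A : 'M[nat]_m) (d : nat) (M : sft A -> 'M[R]_d).
Hypothesis (hm : (2 <= m)%N) (hd : (0 < d)%N).
Hypothesis (hM : holder_continuous M) (hpos : forall x i j, 0 < M x i j).
Implicit Types (x y : sft A).
Notation sh := (@shift_map m A).

Lemma cocycleD n k x : cocycle M (n + k) x = cocycle M n x * cocycle M k (iter n sh x).
Proof.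
rewrite /cocycle big_split_ord /=; congr (_ * _); apply: eq_bigr => i _ /=.
by rewrite addnC iterD.
Qed.

Lemma cocycleS n x : cocycle M n.+1 x = M x * cocycle M n (sh x).
Proof. by rewrite -add1n cocycleD /cocycle big_ord1. Qed.

Lemma cocycle_ge0 n x i j : 0 <= cocycle M n x i j.
Proof.
elim: n x i j => [|n IH] x i j; first by rewrite /cocycle big_ord0 mxE ler0n.
by rewrite cocycleS -mulmxE mxE sumr_ge0 // => k _; rewrite mulr_ge0 // ltW.
Qed.

Lemma row_sum_cocycle_gt0 n x i : 0 < row_sum (cocycle M n x) i.
Proof.
elim: n x i => [|n IH] x i; first by rewrite /cocycle big_ord0 row_sum1.
rewrite cocycleS row_sumM (bigD1 (Ordinal hd)) //= ltr_pwDl ?mulr_gt0 //.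
by rewrite sumr_ge0 // => k _; rewrite ltW ?mulr_gt0.
Qed.

Lemma entry_norm_cocycle_gt0 n x : 0 < entry_norm (cocycle M n x).
Proof.
rewrite /entry_norm (bigD1 (Ordinal hd)) //= ltr_pwDl //.
  exact: row_sum_cocycle_gt0.
by rewrite sumr_ge0 // => i _; exact/ltW/row_sum_cocycle_gt0.
Qed.

(** Points with [n] common letters are at distance at most [m%:R ^- n.+1], a power
    of which is geometric in [n]. *)
Lemma holder_words : exists C th : R, [/\ 0 <= C, 0 < th, th < 1 &
  forall n x y i j, word x n = word y n -> M x i j <= M y i j + C * th ^+ n].
Proof.
have [a [C [a0 hC]]] := hM.
pose th : R := m%:R^-1 `^ a.
have m0 : 0 < m%:R :> R by rewrite ltr0n ltnW.
have th0 : 0 < th by rewrite powR_gt0 ?invr_gt0.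
have th1 : th < 1.
  have one : 1 = 1 `^ a :> R by rewrite powR1.
  rewrite [ltRHS]one; apply: gt0_ltr_powR => //; rewrite ?nnegrE ?invr_ge0 ?ltW //.
  by rewrite invf_lt1 // ltr1n.
exists `|C|, th; split=> // n x y i j xy.
have thn : th ^+ n.+1 = (m%:R ^- n.+1) `^ a.
  by rewrite -powR_mulrn ?(ltW th0) // /th -powRrM mulrC powRrM powR_mulrn ?exprVn.
have h1 : `|(M x - M y) i j| <= mx_norm (M x - M y).
  rewrite /mx_norm; have := @le_bigmax _ _ _ 0 (fun ij => `|(M x - M y) ij.1 ij.2|) (i, j).
  by rewrite -mx_normrE.
have h2 : sft_dist R x y `^ a <= th ^+ n.+1.
  have s0 : 0 <= sft_dist R x y.
    by rewrite /sft_dist /seq_dist; case: pselect => *; rewrite ?invr_ge0 ?exprn_ge0.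
  rewrite thn; apply: (ge0_ler_powR (ltW a0)) => //; rewrite ?nnegrE //.
  exact: word_sft_dist_le.
have h3 : C * sft_dist R x y `^ a <= `|C| * th ^+ n.
  apply: (@le_trans _ _ (`|C| * sft_dist R x y `^ a)).
    by rewrite ler_wpM2r ?powR_ge0 // ler_norm.
  rewrite ler_wpM2l // (le_trans h2) // exprS ler_piMl ?exprn_ge0 // ltW //.
have := le_trans (ler_norm _) (le_trans h1 (le_trans (hC x y) h3)).
by rewrite !mxE; lra.
Qed.

(** Entries are bounded below by compactness: otherwise there would be a point
    at which an entry is as small as one likes. *)
Lemma entries_bounded (x0 : sft A) : exists c0 C0 : R,
  [/\ 0 < c0, 0 < C0 & forall x i j, c0 <= M x i j <= C0].
Proof.
have [C [th [C_ge0 th0 th1 hC]]] := holder_words.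
have [C0 C00 hC0] : exists2 C0, 0 < C0 & forall x i j, M x i j <= C0.
  have invM (ij : 'I_d * 'I_d) : 0 < (M x0 ij.1 ij.2)^-1 by rewrite invr_gt0.
  have [c c0 hc] := finite_positive_lower_bound invM.
  exists (c^-1 + C); first by rewrite ltr_pwDl ?invr_gt0.
  move=> x i j; have := hC 0%N x x0 i j erefl; rewrite expr0 mulr1 => /le_trans; apply.
  by rewrite lerD2r -[leLHS]invrK lef_pV2 ?posrE ?invr_gt0 // (hc (i, j)).
suff [c0 c00 hc0] : exists2 c0, 0 < c0 & forall x i j, c0 <= M x i j.
  by exists c0, C0; split=> // x i j; rewrite hc0 hC0.
apply: contrapT => nolb.
pose B s := forall c : R, 0 < c -> exists2 x, word x (size s) = s & exists i j, M x i j < c.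
have [] := @sft_koenig _ A B.
- move=> c c0; apply: contrapT => h; apply: nolb; exists c => // x i j.
  by rewrite leNgt; apply/negP => hx; apply: h; exists x => //; exists i, j.
- move=> s Bs; apply: contrapT => h.
  have ch a : exists c : R, 0 < c /\ forall x i j, word x (size s).+1 = rcons s a -> c <= M x i j.
    apply: contrapT => ha; apply: h; exists a => c c0; apply: contrapT => hx; apply: ha.
    exists c; split=> // x i j wx; rewrite leNgt; apply/negP => lt; apply: hx.
    by exists x; [rewrite size_rcons|exists i, j].
  have [c c0 hc] := finite_positive_lower_bound (fun a => (svalP (cid (ch a))).1).
  have [x wx [i [j]]] := Bs c c0; rewrite ltNge => /negP; apply.
  apply: (le_trans (hc (sval x (size s)))).
  apply: (svalP (cid (ch _))).2; rewrite -[in RHS]wx.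
  by rewrite /word mkseqS size_mkseq.
- by move=> s /(_ 1 ltr01)[x wx _]; exists x.
move=> x Bx.
have [c c0 hc] := finite_positive_lower_bound (fun ij : 'I_d * 'I_d => hpos x ij.1 ij.2).
have [n hn] : exists n, C * th ^+ n < c / 2.
  have : (fun n => C * th ^+ n) @ \oo --> C * 0.
    by apply: cvgMr; apply: cvg_expr; rewrite ger0_norm ?(ltW th0).
  rewrite mulr0 => /cvgr_lt /(_ (c / 2)); rewrite divr_gt0 // => /(_ isT)[n _ h].
  by exists n; apply: h => /=.
have [|y] := Bx n (c / 2); first by rewrite divr_gt0.
rewrite size_word => wy [i [j Myc]].
have := hC n x y i j (esym wy); have /= := hc (i, j); lra.
Qed.

(** Bounded distortion: the factors compare up to a factor [1 + O(th ^ k)] when [k]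
    letters are still in common, and the product of these ratios converges. *)
Lemma cocycle_distortion (x0 : sft A) : exists2 K : R, 1 <= K & forall n x y,
  word x n = word y n -> entry_norm (cocycle M n x) <= K * entry_norm (cocycle M n y).
Proof.
have [C [th [C_ge0 th0 th1 hC]]] := holder_words.
have [c0 [C0 [c00 C00 hc]]] := entries_bounded x0.
pose K := C / c0 / (1 - th).
have th1' : 0 < 1 - th by rewrite subr_gt0.
have K0 : 0 <= K by rewrite !divr_ge0 // ltW.
(* The exponent is the partial sum of a geometric series of ratio [th]. *)
have main n x y i j : word x n = word y n ->
    cocycle M n x i j <= expR (K * (1 - th ^+ n)) * cocycle M n y i j.
  elim: n x y i j => [|n IH] x y i j xy.
    by rewrite /cocycle !big_ord0 expr0 subrr mulr0 expR0 mul1r.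
  rewrite !cocycleS -!mulmxE !mxE mulr_sumr; apply: ler_sum => k _.
  have step : M x i k <= expR (C / c0 * th ^+ n) * M y i k.
    have /andP[cM _] := hc y i k.
    rewrite (le_trans (hC n x y i k (word_take_eq (leqnSn n) xy))) //.
    rewrite (@le_trans _ _ ((1 + C / c0 * th ^+ n) * M y i k)) //; last first.
      by rewrite ler_wpM2r ?expR_ge1Dx // ltW.
    have -> : (1 + C / c0 * th ^+ n) * M y i k =
        M y i k + C * th ^+ n * (M y i k / c0) by ring.
    rewrite lerD2l ler_peMr ?mulr_ge0 ?exprn_ge0 ?(ltW th0) //.
    by rewrite ler_pdivlMr // mul1r.
  have -> : K * (1 - th ^+ n.+1) = C / c0 * th ^+ n + K * (1 - th ^+ n).
    by rewrite /K exprS; field; rewrite !gt_eqF.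
  rewrite expRD mulrACA ler_pM ?(ltW (hpos _ _ _)) ?cocycle_ge0 //.
  by apply: IH; rewrite !word_shift xy.
exists (expR K); first by rewrite -expR0 ler_expR.
move=> n x y xy; rewrite /entry_norm mulr_sumr; apply: ler_sum => i _.
rewrite mulr_sumr; apply: ler_sum => j _; rewrite (le_trans (main n x y i j xy)) //.
rewrite ler_wpM2r ?cocycle_ge0 // ler_expR ler_piMr // gerBl exprn_ge0 // ltW //.
Qed.

(** The rows of the leftmost factor of a product have comparable entries, so the
    row sums of the product are comparable, as [entry_norm_supermult] requires. *)
Lemma cocycle_quasi_multiplicative (x0 : sft A) : exists2 K : R, 1 <= K & forall n k x,
  entry_norm (cocycle M (n + k) x) <=
    K * (entry_norm (cocycle M n x) * entry_norm (cocycle M k (iter n sh x))) /\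
  entry_norm (cocycle M n x) * entry_norm (cocycle M k (iter n sh x)) <=
    K * entry_norm (cocycle M (n + k) x).
Proof.
have [c0 [C0 [c00 C00 hc]]] := entries_bounded x0.
pose kappa := C0 / c0.
have kappa1 : 1 <= kappa.
  rewrite ler_pdivlMr // mul1r.
  by have /andP[/le_trans h /h] := hc x0 (Ordinal hd) (Ordinal hd).
have rows k x i j : row_sum (cocycle M k x) i <= kappa * row_sum (cocycle M k x) j.
  case: k => [|k]; first by rewrite /cocycle big_ord0 !row_sum1 mulr1.
  rewrite cocycleS !row_sumM mulr_sumr; apply: ler_sum => l _.
  rewrite mulrA ler_wpM2r ?(ltW (row_sum_cocycle_gt0 _ _ _)) //.
  have /andP[_ h1] := hc x i l; have /andP[h2 _] := hc x j l.
  by rewrite (le_trans h1) // /kappa mulrAC ler_pdivlMr // ler_pM2l.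
have d1 : 1 <= d%:R :> R by rewrite ler1n.
have K1 : 1 <= d%:R * kappa by rewrite -[leLHS]mulr1 ler_pM.
exists (d%:R * kappa) => // n k x; split.
  rewrite cocycleD (le_trans (entry_norm_submult (@cocycle_ge0 _ _) (@cocycle_ge0 _ _))) //.
  by rewrite ler_peMl // mulr_ge0 // ltW // entry_norm_cocycle_gt0.
rewrite cocycleD; apply: entry_norm_supermult; first exact: cocycle_ge0.
exact: rows.
Qed.

End PositiveCocycle.

(** * The weights of the words and the pressure *)

(** Comparability in both directions is needed because [q] may be negative. *)
Lemma powR_comparable (R : realType) (q K a b : R) : 0 < a -> 0 < b -> 1 <= K ->
  a <= K * b -> b <= K * a -> a `^ q <= K `^ `|q| * b `^ q.
Proof.
move=> a0 b0 K1 ab ba; have K0 : 0 < K by rewrite (lt_le_trans ltr01).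
rewrite /powR !gt_eqF // -expRD ler_expR.
have lnab : ln a <= ln K + ln b by rewrite -lnM ?posrE // ler_ln ?posrE ?mulr_gt0.
have lnba : ln b <= ln K + ln a by rewrite -lnM ?posrE // ler_ln ?posrE ?mulr_gt0.
have : q * (ln a - ln b) <= `|q| * ln K.
  rewrite (le_trans (ler_norm _)) // normrM ler_wpM2l //.
  by rewrite ler_norml; apply/andP; split; lra.
by rewrite mulrBr; lra.
Qed.

Section OrbitWeights.
Variables (R : realType) (m : nat) (A : 'M[nat]_m) (d : nat) (M : sft A -> 'M[R]_d).
Hypothesis (hm : (2 <= m)%N) (A01 : zero_one_mx A) (hA : primitive_mx A).
Hypothesis (hd : (0 < d)%N) (hM : holder_continuous M).
Hypothesis hpos : forall x i j, 0 < M x i j.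
Variable q : R.
Implicit Types (x y : sft A) (s t : seq 'I_m).
Notation sh := (@shift_map m A).
Notation adm := (fun i j => A i j == 1%N).

Let phi n x := entry_norm (cocycle M n x).

Let phi_gt0 n x : 0 < phi n x. Proof. exact: entry_norm_cocycle_gt0. Qed.

Let x0 : sft A := sval (cid (sft_nonempty hm A01 hA)).

Lemma primitive_next i : exists j, A i j = 1%N.
Proof.
have [L /(_ i i)[u [_]]] := primitive_gap A01 hm hA.
by case: u => [|a u] /= /andP[/eqP Aia _]; [exists i | exists a].
Qed.

(** The weight of an admissible word is read at an arbitrary point of its
    cylinder; by bounded distortion the choice matters only up to a factor. *)
Definition orbit_weight s : R :=
  if pselect (exists x : sft A, word x (size s) = s) is left e
  then phi (size s) (sval (cid e)) `^ q else 0.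

Lemma orbit_weight_ge0 s : 0 <= orbit_weight s.
Proof. by rewrite /orbit_weight; case: pselect => // ?; exact: powR_ge0. Qed.

Lemma orbit_weight_gt0 x n : 0 < orbit_weight (word x n).
Proof.
rewrite /orbit_weight size_word; case: pselect => [e|[]]; last by exists x.
exact: powR_gt0.
Qed.

Lemma orbit_weight_sorted s : 0 < orbit_weight s -> sorted adm s.
Proof.
rewrite /orbit_weight; case: pselect => [e _|]; last by rewrite ltxx.
by case: e => x <-; exact: word_of_point.
Qed.

Lemma orbit_weight_point s : orbit_weight s = 0 \/ exists x, word x (size s) = s.
Proof. by rewrite /orbit_weight; case: pselect => [|_]; [right | left]. Qed.

Lemma orbit_weight_comparable : exists2 K : R, 1 <= K & forall n x,
  orbit_weight (word x n) <= K * phi n x `^ q /\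
  phi n x `^ q <= K * orbit_weight (word x n).
Proof.
have [K K1 hK] := cocycle_distortion hm hM hpos x0.
exists (K `^ `|q|); first by rewrite -(powRr0 K) ler_powR.
move=> n x; rewrite /orbit_weight; case: pselect => [e|[]]; last first.
  by exists x; rewrite size_word.
case: cid => y /=; rewrite size_word => yx.
by split; apply: powR_comparable => //; apply: hK.
Qed.

(** Both inequalities come from quasi-multiplicativity at a point of the
    concatenated word.  For the lower one, a single connecting word suffices;
    its weight is bounded below because there are finitely many words of length
    [gap]. *)
Lemma orbit_weight_quasi_bernoulli : exists D gap, quasi_bernoulli orbit_weight D gap.
Proof.
have [K K1 hK] := orbit_weight_comparable.
have K0 : 0 < K by rewrite (lt_le_trans ltr01).
have [Q0 Q01 hQ0] := cocycle_quasi_multiplicative hm hd hM hpos x0.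
pose Q := Q0 `^ `|q|.
have Qpos : 0 < Q by rewrite powR_gt0 // (lt_le_trans ltr01).
have hQ n k x : phi (n + k) x `^ q <= Q * (phi n x `^ q * phi k (iter n sh x) `^ q) /\
    phi n x `^ q * phi k (iter n sh x) `^ q <= Q * phi (n + k) x `^ q.
  have [h1 h2] := hQ0 n k x.
  by rewrite -powRM ?(ltW (phi_gt0 _ _)) //; split; apply: powR_comparable => //; rewrite mulr_gt0.
have split_word s t x : word x (size (s ++ t)) = s ++ t ->
    word x (size s) = s /\ word (iter (size s) sh x) (size t) = t.
  rewrite size_cat => wx; split.
    by rewrite -(take_word x _ (size t)) wx take_size_cat.
  by rewrite -drop_word wx drop_size_cat.
pose E := K ^+ 3 * Q.
have K2 : 0 < K * K by rewrite mulr_gt0.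
have E0 : 0 < E by rewrite mulr_gt0 // exprn_gt0.
have up s t : orbit_weight (s ++ t) <= E * (orbit_weight s * orbit_weight t).
  have [->|[x wx]] := orbit_weight_point (s ++ t).
    by apply: mulr_ge0 (ltW E0) (mulr_ge0 (orbit_weight_ge0 _) (orbit_weight_ge0 _)).
  have [wsx wtx] := split_word _ _ _ wx.
  have [h _] := hK (size (s ++ t)) x; rewrite wx in h.
  have [_ hs] := hK (size s) x; rewrite wsx in hs.
  have [_ ht] := hK (size t) (iter (size s) sh x); rewrite wtx in ht.
  have [hq _] := hQ (size s) (size t) x; rewrite -size_cat in hq.
  apply: (le_trans h); apply: (@le_trans _ _ (K * (Q * (K * orbit_weight s * (K * orbit_weight t))))).
    rewrite ler_pM2l // (le_trans hq) // ler_pM2l //.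
    by rewrite ler_pM ?powR_ge0.
  by rewrite /E exprS expr2 le_eqVlt; apply/orP; left; apply/eqP; ring.
have low s t x : word x (size (s ++ t)) = s ++ t ->
    orbit_weight s * orbit_weight t <= E * orbit_weight (s ++ t).
  move=> wx; have [wsx wtx] := split_word _ _ _ wx.
  have [_ h] := hK (size (s ++ t)) x; rewrite wx in h.
  have [hs _] := hK (size s) x; rewrite wsx in hs.
  have [ht _] := hK (size t) (iter (size s) sh x); rewrite wtx in ht.
  have [_ hq] := hQ (size s) (size t) x; rewrite -size_cat in hq.
  apply: (@le_trans _ _ (K * K * (Q * (K * orbit_weight (s ++ t))))).
    apply: (@le_trans _ _ (K * phi (size s) x `^ q * (K * phi (size t) (iter (size s) sh x) `^ q))).
      by rewrite ler_pM ?orbit_weight_ge0.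
    by rewrite mulrACA ler_pM2l // (le_trans hq) // ler_pM2l.
  by rewrite /E exprS expr2 le_eqVlt; apply/orP; left; apply/eqP; ring.
have [L hL] := primitive_gap A01 hm hA.
pose f (J : L.-tuple 'I_m) := if orbit_weight J == 0 then 1 else orbit_weight J.
have f0 J : 0 < f J.
  by rewrite /f; case: eqP => // /eqP w0; rewrite lt_neqAle eq_sym w0 orbit_weight_ge0.
have [c c0 hc] := finite_positive_lower_bound f0.
have connect s t : sorted adm s -> sorted adm t ->
    exists u, size u = L /\ sorted adm (s ++ u ++ t).
  pose a := sval x0 0%N.
  move=> hs ht.
  have [u [su]] := hL (last a s) (head a t); rewrite -cats1 => pu.
  exists u; split=> //.
  have pt : path adm (last a s) (u ++ t).
    move: pu; rewrite !cat_path => /andP[-> /=]; rewrite andbT.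
    by case: t ht => //= b t -> ->.
  case: s hs {pu} pt => [|b s] /= hs pt; first exact: path_sorted pt.
  by rewrite cat_path hs.
exists (E + E * E / c), L; split.
- exact: orbit_weight_ge0.
- by rewrite addr_gt0 // divr_gt0 // mulr_gt0.
- move=> s t; rewrite (le_trans (up s t)) // ler_wpM2r ?mulr_ge0 ?orbit_weight_ge0 //.
  by rewrite lerDl divr_ge0 ?mulr_ge0 ?ltW.
move=> s t; have S0 : 0 <= wsum L (fun u => orbit_weight (s ++ u ++ t)).
  by apply: wsum_ge0 => u; exact: orbit_weight_ge0.
rewrite mulrDl -[leLHS]add0r lerD //; first by rewrite mulr_ge0 // ltW.
have [->|[x wx]] := orbit_weight_point s.
  by rewrite mul0r mulr_ge0 ?divr_ge0 ?mulr_ge0 // ltW.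
have [->|[y wy]] := orbit_weight_point t.
  by rewrite mulr0 mulr_ge0 ?divr_ge0 ?mulr_ge0 // ltW.
have hs : sorted adm s by rewrite -wx; exact: word_of_point.
have ht : sorted adm t by rewrite -wy; exact: word_of_point.
have [u [su hu]] := connect s t hs ht.
have [z wz] := point_of_word primitive_next x0 hu.
have [_ wz'] := split_word _ _ _ wz.
have wu : c <= orbit_weight u.
  have := hc (tcast su (in_tuple u)); rewrite /f val_tcast /=.
  have [wu _] := split_word _ _ _ wz'.
  by rewrite gt_eqF // -wu orbit_weight_gt0.
rewrite [leRHS]mulrAC ler_pdivlMr //.
apply: (@le_trans _ _ (orbit_weight s * (orbit_weight u * orbit_weight t))).
  by rewrite -mulrA ler_wpM2l ?orbit_weight_ge0 // mulrC ler_wpM2r ?orbit_weight_ge0.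
apply: (@le_trans _ _ (orbit_weight s * (E * orbit_weight (u ++ t)))).
  by rewrite ler_wpM2l ?orbit_weight_ge0 // (low _ _ (iter (size s) sh z)).
rewrite mulrCA -[leRHS]mulrA ler_pM2l // (le_trans (low _ _ _ wz)) // ler_pM2l //.
by apply: (@wsum_ge_term _ _ L (fun u => orbit_weight (s ++ u ++ t))) => // ?; exact: orbit_weight_ge0.
Qed.

(** The supremum over a cylinder and the chosen weight differ by a bounded
    factor, which the logarithmic average forgets. *)
Lemma pressure_orbit_weight (P c C : R) : 0 < c -> 0 < C ->
  (forall n, c * expR (n%:R * P) <= wsum n orbit_weight <= C * expR (n%:R * P)) ->
  pressure M q = P.
Proof.
move=> c0 C0 hZ.
have [K K1 hK] := orbit_weight_comparable.
have K0 : 0 < K by rewrite (lt_le_trans ltr01).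
pose Y n := \sum_(J : n.-tuple 'I_m | admissible A J)
  sup [set entry_norm (cocycle M n x) `^ q | x in cylinder A J].
have sup_bounds n (J : n.-tuple 'I_m) : admissible A J ->
    orbit_weight J <= K * sup [set phi n x `^ q | x in cylinder A J] /\
    sup [set phi n x `^ q | x in cylinder A J] <= K * orbit_weight J.
  move=> hJ; set S := (X in sup X).
  have [y wy] := point_of_word primitive_next x0 hJ.
  rewrite size_tuple in wy.
  have Jy : cylinder A J y by rewrite cylinderE.
  have ubS : ubound S (K * orbit_weight J).
    move=> r [x]; rewrite cylinderE /= => wx <-.
    by have [_] := hK n x; rewrite wx.
  have Sy : S (phi n y `^ q) by exists y.
  split; last by apply: ge_sup => //; exists (phi n y `^ q).
  have [h _] := hK n y; rewrite wy in h; rewrite (le_trans h) // ler_pM2l //.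
  by apply: ub_le_sup => //; exists (K * orbit_weight J).
have ZE n : wsum n orbit_weight = \sum_(J : n.-tuple 'I_m | admissible A J) orbit_weight J.
  rewrite wsumE [RHS]big_mkcond /=; apply: eq_bigr => J _; case: ifPn => // nJ.
  apply/eqP; rewrite eq_le orbit_weight_ge0 andbT leNgt; apply/negP => /orbit_weight_sorted.
  by apply/negP.
have ZY n : wsum n orbit_weight <= K * Y n.
  by rewrite ZE mulr_sumr; apply: ler_sum => J /sup_bounds[].
have YZ n : Y n <= K * wsum n orbit_weight.
  by rewrite ZE mulr_sumr; apply: ler_sum => J /sup_bounds[].
have Z0 n : 0 < wsum n orbit_weight.
  by have /andP[h _] := hZ n; rewrite (lt_le_trans _ h) // mulr_gt0 ?expR_gt0.
have Y0 n : 0 < Y n by rewrite -(pmulr_rgt0 _ K0) (lt_le_trans (Z0 n)).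
pose B := `|ln (c / K)| + `|ln (C * K)|.
have lnY n : `|ln (Y n) - n%:R * P| <= B.
  have /andP[h1 h2] := hZ n.
  have l1 : ln (c / K) + n%:R * P <= ln (Y n).
    rewrite -[X in _ + X]expRK -lnM ?posrE ?divr_gt0 ?expR_gt0 //.
    rewrite ler_ln ?posrE ?mulr_gt0 ?invr_gt0 ?expR_gt0 //.
    by rewrite mulrAC ler_pdivrMr // [leRHS]mulrC (le_trans h1).
  have l2 : ln (Y n) <= ln (C * K) + n%:R * P.
    rewrite -[X in _ <= _ + X]expRK -lnM ?posrE ?mulr_gt0 ?expR_gt0 //.
    rewrite ler_ln ?posrE ?mulr_gt0 ?expR_gt0 //.
    by rewrite (le_trans (YZ n)) // [leRHS]mulrAC [leRHS]mulrC ler_pM2l.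
  have := ler_norm (- ln (c / K)); have := ler_norm (ln (C * K)).
  have := normr_ge0 (ln (c / K)); have := normr_ge0 (ln (C * K)).
  rewrite normrN /B ler_norml => *; apply/andP; split; lra.
apply/cvg_lim => //; apply/cvgrPdist_le => /= e e0.
near=> n.
have n0 : 0 < n%:R :> R by rewrite ltr0n; near: n; exists 1%N.
have -> : P - n%:R^-1 * ln (Y n) = - (n%:R^-1 * (ln (Y n) - n%:R * P)).
  by field; rewrite gt_eqF.
rewrite normrN normrM (@ger0_norm _ n%:R^-1) ?invr_ge0 ?ler0n // ler_pdivrMl //.
rewrite (le_trans (lnY n)) // -ler_pdivrMr //.
near: n; exists (Num.Def.archi_bound (B / e)) => // n /= hn.
apply: (@le_trans _ _ (Num.Def.archi_bound (B / e))%:R); last by rewrite ler_nat.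
by apply/ltW/archi_boundP; rewrite divr_ge0 ?addr_ge0 // ltW.
Unshelve. all: by end_near.
Qed.

End OrbitWeights.

(** * Existence and uniqueness of the Gibbs measure *)

Theorem theorem1p1 (R : realType) (m : nat) (hm : (2 <= m)%N)
    (A : 'M[nat]_m) (hA01 : zero_one_mx A) (hA : primitive_mx A)
    (d : nat) (hd : (0 < d)%N) (M : sft A -> 'M[R]_d)
    (hM : holder_continuous M) (hpos : forall x i j, 0 < M x i j) (q : R) :
  exists mu : probability (borel_sft R (sft_nonempty hm hA01 hA)) R,
    [/\ shift_invariant mu, ergodic mu & gibbs_bounds M q mu] /\
    forall nu : probability (borel_sft R (sft_nonempty hm hA01 hA)) R,
      [/\ shift_invariant nu, ergodic nu & gibbs_bounds M q nu] ->
      forall B, measurable B -> nu B = mu B.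
Proof.
set ne := sft_nonempty hm hA01 hA.
pose w := orbit_weight M q.
have w_ge0 s : 0 <= w s by exact: orbit_weight_ge0.
have [D [gap qb]] := orbit_weight_quasi_bernoulli hm hA01 hA hd hM hpos q.
have Z0 n : 0 < wsum n w.
  apply: (@lt_le_trans _ _ (w (word (sval (cid ne)) n))); first exact: orbit_weight_gt0.
  by apply: wsum_ge_term; rewrite ?size_word.
have [P [c [C [c0 C0 hZ]]]] := quasi_bernoulli_pressure qb Z0.
have PE : pressure M q = P := pressure_orbit_weight hm hA01 hA hd hM hpos c0 C0 hZ.
pose v s := expR (- ((size s)%:R * P)) * w s.
have [E qbv] := quasi_bernoulli_normalize P qb.
have vZ n : c <= wsum n v <= C.
  rewrite (@eq_wsum _ _ n v (fun s => expR (- (n%:R * P)) * w s)); last first.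
    by move=> s sn; rewrite /v sn.
  rewrite wsumZ expRN mulrC ler_pdivlMr ?ler_pdivrMr ?expR_gt0 //.
have [p [p_nil p_rcons p_cons pv]] := invariant_word_measure qbv c0 vZ.
have [cp [Cp [cp0 Cp0 hp]]] := pv.
have p_ge0 s : 0 <= p s.
  by have /andP[h _] := hp s; rewrite (le_trans _ h) // !mulr_ge0 ?expR_ge0 // ltW.
have p_adm s : 0 < p s -> sorted (fun i j => A i j == 1%N) s.
  move=> ps; apply: (orbit_weight_sorted (M := M) (q := q)).
  have /andP[_ h] := hp s; have := lt_le_trans ps h.
  by rewrite pmulr_rgt0 // pmulr_rgt0 // expR_gt0.
have [mu mu_p] := measure_of_words hm ne p_ge0 p_nil p_rcons p_adm.
have [K [K0 mix]] := comparable_quasi_bernoulli qbv pv.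
have mu_inv := shift_invariant_of_words hm mu_p p_cons.
have mu_erg := ergodic_of_words hm mu_p mu_inv K0 mix.
have [Q Q1 hQ] := orbit_weight_comparable hm hA01 hA hd hM hpos q.
have Q0 : 0 < Q by rewrite (lt_le_trans ltr01).
pose den n x := expR (- (n%:R * P)) * entry_norm (cocycle M n x) `^ q.
have den_gt0 n x : 0 < den n x.
  by rewrite mulr_gt0 ?expR_gt0 // powR_gt0 // entry_norm_cocycle_gt0.
have den_v n x : v (word x n) <= Q * den n x /\ den n x <= Q * v (word x n).
  by rewrite /v /den size_word !(mulrCA Q) !ler_pM2l ?expR_gt0.
have cyl_word n (J : n.-tuple 'I_m) x : cylinder A J x -> word x n = J.
  by rewrite cylinderE.
have mu_cyl n (J : n.-tuple 'I_m) : mu (cylinder A J) = (p J)%:E.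
  rewrite -mu_p; congr (mu _); rewrite cylinderE size_tuple.
  by apply/seteqP; split=> y; rewrite /clopen /= => /eqP.
have mu_gibbs : gibbs_bounds M q mu.
  exists (cp / Q), (Cp * Q); split; [exact: divr_gt0|exact: mulr_gt0|].
  move=> n J x n0 admJ /cyl_word wx; rewrite PE mu_cyl /= -/(den n x).
  have [h1 h2] := den_v n x; rewrite wx in h1 h2.
  have /andP[h3 h4] := hp J.
  rewrite ler_pdivlMr // ler_pdivrMr //; apply/andP; split.
    by rewrite mulrAC ler_pdivrMr // (le_trans _ (ler_wpM2r (ltW Q0) h3)) // -mulrA ler_pM2l // mulrC.
  by rewrite (le_trans h4) // -mulrA ler_pM2l.
exists mu; split=> // nu [nu_inv _ [D1 [D2 [D10 D20 nu_gibbs]]]].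
have [c1 [c2 [c10 c20 mu_gibbs']]] := mu_gibbs.
have D2c1 : 0 < D2 / c1 by rewrite divr_gt0.
(* The summand [1] covers the empty word, whose cylinder is the whole space. *)
apply: (unique_of_words hm mu_inv mu_erg nu_inv (c := D2 / c1 + 1)).
  by rewrite addr_gt0.
case=> [|a s].
  have -> : clopen (size ([::] : seq 'I_m)) (pred1 [::]) = setT :> set (borel_sft R ne).
    by apply/seteqP; split.
  by rewrite !probability_setT mule1 lee_fin lerDr ltW.
set t := a :: s.
have [[x wx]|nox] := pselect (exists x : sft A, word x (size t) = t); last first.
  have -> : clopen (size t) (pred1 t) = set0 :> set (borel_sft R ne).
    by apply/seteqP; split=> // y; rewrite /clopen /= => /eqP yt; apply: nox; exists y.
  by rewrite !measure0 mule0.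
have finite_clopen (la : probability (borel_sft R ne) R) :
    la (clopen (size t) (pred1 t)) = (fine (la (cylinder A (in_tuple t))))%:E.
  have -> : cylinder A (in_tuple t) = clopen (size t) (pred1 t) :> set (borel_sft R ne).
    by rewrite cylinderE; apply/seteqP; split=> y; rewrite /clopen /= => /eqP.
  by rewrite fineK // fin_num_measure //; exact: measurable_clopen.
have admt : admissible A (in_tuple t) by have := word_of_point x (size t); rewrite wx.
have tx : cylinder A (in_tuple t) x by rewrite cylinderE.
have /andP[_ h1] := nu_gibbs _ (in_tuple t) x (ltn0Sn _) admt tx.
have /andP[h2 _] := mu_gibbs' _ (in_tuple t) x (ltn0Sn _) admt tx.
rewrite PE -/(den _ x) ler_pdivrMr // in h1.
rewrite PE -/(den _ x) ler_pdivlMr // in h2.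
rewrite !finite_clopen -EFinM lee_fin mulrDl mul1r (le_trans h1) //.
rewrite -[leLHS]addr0 lerD ?fine_ge0 ?measure_ge0 //.
by rewrite mulrAC ler_pdivlMr // -mulrA ler_pM2l // mulrC.
Qed.
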